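(* Suppose a group $G$ acts by isometries, acylindrically with constants $K(R), L(R)$, on a $\delta$-hyperbolic graph $\Gamma$. Then there exists a constant $M$, which depends only on $\delta$ and $K(20\delta), L(20\delta), K(200\delta)$, with the following property. Suppose $a,b\in G$ act as hyperbolic isometries on $\Gamma$, and assume that $[a^p,b^q]\neq 1$ in $G$ for all integers $p,q\neq 0$. Then for any integers $n,m\ge M$, the subgroup $\langle a^n,b^m\rangle$ of $G$ is free of rank two. Moreover, the embedding of $\langle a^n,b^m\rangle$ in $\Gamma$ by an orbit is quasi-isometric. In particular, all non-trivial elements of $\langle a^n,b^m\rangle$ act as hyperbolic isometries on $\Gamma$.
   Context: A geodesic space is $\delta$-hyperbolic ($\delta\ge 0$) if for every geodesic triangle each side is contained in the $\delta$-neighborhood of the union of the other two sides. A graph is regarded as a geodesic space with all edges of length $1$; $G$ acts by isometries (graph automorphisms). The action of $G$ on $\Gamma$ is acylindrical with constants $K(R), L(R)$ if for every $R\ge 0$ the numbers $K(R), L(R)\ge 1$ are such that for any vertices $x,y\in\Gamma$ with $d(x,y)\ge L(R)$ the set $\{g\in G : d(x,g(x))\le R,\ d(y,g(y))\le R\}$ has at most $K(R)$ elements. An isometry $a$ of $\Gamma$ is hyperbolic if there are a point $x\in\Gamma$ and a constant $C>0$ with $d(x,a^n(x))\ge Cn$ for all $n>0$. $[f,g]=f^{-1}g^{-1}fg$. For a finitely generated subgroup $H$ acting on $\Gamma$, with word length $|h|$ for a fixed finite generating set, the embedding of $H$ in $\Gamma$ by an orbit is the map $h\mapsto h(x)$ for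 a point $x\in\Gamma$; it is quasi-isometric if there are constants $L,C>0$ with $|h|/L-C\le d(x,h(x))\le L|h|+C$ for all $h\in H$. This property does not depend on the choice of $x$ or of the generating set. *)

(* Defs.v *)
From mathcomp Require Import all_boot all_order all_algebra.
From mathcomp Require Import all_classical all_reals.

Set Implicit Arguments.
Unset Strict Implicit.
Unset Printing Implicit Defensive.

Import Order.TTheory GRing.Theory Num.Theory.

Local Open Scope classical_set_scope.
Local Open Scope card_scope.
Local Open Scope ring_scope.

Section Groups.
Variable G : groupType.

Definition zpow (x : G) (n : int) : G :=
  (match n with Posz k => x ^+ k | Negz k => x ^- k.+1 end)%g.

Definition is_subgroup (H : set G) : Prop :=
  [/\ H 1%g,
      forall x y, H x -> H y -> H (x * y)%g
    & forall x, H x -> H x^-1%g].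

Definition generated (S : set G) : set G := smallest is_subgroup S.

(* A letter (i, true) stands for x i and (i, false) for its inverse. *)
Definition word_eval (I : Type) (x : I -> G) (w : seq (I * bool)) : G :=
  (\prod_(u <- w) (if u.2 then x u.1 else (x u.1)^-1))%g.

Definition reduced (I : eqType) (w : seq (I * bool)) : bool :=
  sorted (fun u v => v != (u.1, ~~ u.2)) w.

(* The second clause forces x to be injective (look at x i * (x j)^-1). *)
Definition free_basis (I : eqType) (x : I -> G) (H : set G) : Prop :=
  generated (range x) = H /\
  forall w, reduced w -> w != [::] -> word_eval x w <> 1%g.

Definition free_of_rank (k : nat) (H : set G) : Prop :=
  exists x : 'I_k -> G, free_basis x H.

End Groups.

Section WordLength.
Variables (R : realType) (G : groupType).

(* Meaningful for h in generated S; the infimum is then attained. *)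
Definition word_length (S : set G) (h : G) : R :=
  inf [set (size w)%:R | w in
         [set w : seq G | (forall g, g \in w -> S g \/ S g^-1%g) /\
                          (\prod_(g <- w) g)%g = h]].

End WordLength.

Section Metric.
Variables (R : realType) (X : Type) (d : X -> X -> R).

Definition geodesic_segment (p q : X) (A : set X) : Prop :=
  exists c : R -> X,
    [/\ c 0 = p,
        c (d p q) = q,
        forall s t, 0 <= s <= d p q -> 0 <= t <= d p q ->
          d (c s) (c t) = `|s - t|
      & A = [set c t | t in [set t | 0 <= t <= d p q]]].

Definition geodesic_space : Prop :=
  forall p q, exists A, geodesic_segment p q A.

(* The neighborhood is closed, so that delta = 0 is meaningful. *)
Definition neighborhood (delta : R) (A : set X) : set X :=
  [set p | exists2 q, A q & d p q <= delta].

Definition slim_triangles (delta : R) : Prop :=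
  forall (p q r : X) (A B C : set X),
    geodesic_segment p q A -> geodesic_segment q r B ->
    geodesic_segment r p C ->
    [/\ A `<=` neighborhood delta (B `|` C),
        B `<=` neighborhood delta (C `|` A)
      & C `<=` neighborhood delta (A `|` B)].

Definition hyperbolic_space (delta : R) : Prop :=
  geodesic_space /\ slim_triangles delta.

Definition hyperbolic_isometry (f : X -> X) : Prop :=
  exists (x : X) (C : R), 0 < C /\
    forall n : nat, (0 < n)%N -> C * n%:R <= d x (iter n f x).

Definition isometric_action (G : groupType) (act : G -> X -> X) : Prop :=
  [/\ forall p, act 1%g p = p,
      forall g h p, act (g * h)%g p = act g (act h p)
    & forall g p q, d (act g p) (act g q) = d p q].

Definition qi_orbit_embedding (G : groupType) (act : G -> X -> X)
    (S : set G) (x : X) : Prop :=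
  exists L C : R, [/\ 0 < L, 0 < C &
    forall h, generated S h ->
      word_length R S h / L - C <= d x (act h x)
        <= L * word_length R S h + C].

End Metric.

(* Loops and multiple edges are allowed.  Edges are unoriented: the order of
   their two ends only fixes a parametrization of the edge by [0, 1]. *)
Record graph := Graph {
  vertex : Type;
  edge : Type;
  end0 : edge -> vertex;
  end1 : edge -> vertex
}.

Section Realization.
Variables (R : realType) (Gam : graph).

(* The geometric realization, as a set. *)
Inductive gpoint :=
| Vtx of vertex Gam
| Inner of edge Gam & {t : R | 0 < t < 1}.

(* The point of parameter t on the closed edge e; relevant for t in [0, 1]. *)
Definition edge_point (e : edge Gam) (t : R) : gpoint :=
  match insub t with
  | Some u => Inner e u
  | None => Vtx (if t <= 0 then end0 e else end1 e)
  end.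

(* Piecewise linear paths from p to q, with their length. *)
Inductive pl_path : gpoint -> gpoint -> R -> Prop :=
| pl_nil p : pl_path p p 0
| pl_cons e s t q l :
    0 <= s <= 1 -> 0 <= t <= 1 ->
    pl_path (edge_point e t) q l ->
    pl_path (edge_point e s) q (`|s - t| + l).

(* The length metric for which every edge has length 1.  As inf set0 = 0,
   points in different components get distance 0, so [geodesic_space gdist]
   includes the connectedness of the graph. *)
Definition gdist (p q : gpoint) : R := inf [set l | pl_path p q l].

(* Maps induced by a morphism of graphs; an edge may be reversed. *)
Definition graph_map (f : gpoint -> gpoint) : Prop :=
  (forall v, exists w, f (Vtx v) = Vtx w) /\
  forall e, exists e',
    (forall t, 0 <= t <= 1 -> f (edge_point e t) = edge_point e' t) \/
    (forall t, 0 <= t <= 1 -> f (edge_point e t) = edge_point e' (1 - t)).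

(* Each act g is an automorphism, its inverse being act g^-1. *)
Definition graph_action (G : groupType) (act : G -> gpoint -> gpoint) : Prop :=
  isometric_action gdist act /\ forall g, graph_map (act g).

Definition acylindrical (G : groupType) (act : G -> gpoint -> gpoint)
    (K L : R -> R) : Prop :=
  forall r, 0 <= r ->
    [/\ 1 <= K r, 1 <= L r &
      forall x y : vertex Gam, L r <= gdist (Vtx x) (Vtx y) ->
        exists2 k : nat, k%:R <= K r &
          [set g : G | gdist (Vtx x) (act g (Vtx x)) <= r /\
                       gdist (Vtx y) (act g (Vtx y)) <= r] #<= `I_k].

End Realization.

(* Main.v *)
(* The idea is to let the element with the larger translation length per
   exponent, say a, control everything.  On the vertices all estimates use only
   the four-point inequality (constant 3 delta) and integer distances, so that
   acylindricity at 20 delta suffices: elements moving two far apart vertices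
   by at most D fall into boundedly many classes, and two elements of the same
   class differ by one that moves deep vertices by at most 18 delta.  This
   gives a uniform lower bound for translation lengths, and shows that if an
   axis of a and its translate by some power g of b overlap much longer than a
   translates, then the elements g a^{+-i} g^-1 a^i, which move points by
   O(delta), cannot all be distinct; hence g^2 commutes with a power of a,
   against the hypothesis.  Consequently there is a point x on the axis of a^n
   such that every translate of the axis by b^{mj}, j <> 0, projects to the axis
   within a tenth of the displacement of a^n from x, and broken paths along a reduced
   word w satisfy |w| <= d(x, w x). *)

Require Import Defs.
From mathcomp Require Import all_boot all_order all_algebra.
From mathcomp Require Import all_classical all_reals.
From mathcomp Require Import zify ring lra.

Set Implicit Arguments.
Unset Strict Implicit.
Unset Printing Implicit Defensive.

Import Order.TTheory GRing.Theory Num.Theory.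

Local Open Scope classical_set_scope.
Local Open Scope ring_scope.

(** The element [a] may translate by less than [e], so no axis can be built from it directly; the
    axis is the nonempty set of vertices that [a ^+ n] moves least. What must then be shown is that
    [a ^+ i] displaces such a vertex by [i / n] times the displacement [S] of [a ^+ n], with an
    error that is a multiple of [e] independent of [i] and [n]. Since [S] has no upper bound,
    thresholds are fractions of [S]. The overlap that gives a contradiction has length a bounded
    multiple of [S / n] plus a constant, which is a small part of [S] once [n] is large. A long
    overlap arises in two ways. With [h] a power of [b], either an axis runs along the path from [x]
    to [h x], or it meets the translated axis beyond that path. The first says nothing about [h],
    which may move points far; but [b] commutes with [h] and, having the smaller translation length
    per exponent, moves both ends of the path little, so that [b] takes the place of [h]. *)

Lemma archi_le (R : realType) (x y c : R) :
  (forall N : nat, N%:R * x <= N%:R * y + c) -> x <= y.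
Proof.
move=> H; rewrite leNgt; apply/negP => xy.
have xy0 : 0 < x - y by rewrite subr_gt0.
pose N := (Num.truncn (c / (x - y))).+1.
have : c / (x - y) < N%:R by exact: truncnS_gt.
rewrite ltr_pdivrMr // => Hc.
have := H N; lra.
Qed.

Lemma ex_nat_above (R : realType) (r : R) :
  0 <= r -> exists2 k : nat, r < k%:R & k%:R <= r + 1.
Proof.
move=> r0; exists (Num.truncn r).+1; first exact: truncnS_gt.
by rewrite -natr1 lerD2r; have /andP[] := truncn_itv r0.
Qed.

Lemma ex_nat_below (R : realType) (r : R) :
  0 <= r -> exists2 k : nat, k%:R <= r & r < k%:R + 1.
Proof.
by move=> r0; exists (Num.truncn r); have /andP[] := truncn_itv r0; rewrite -?natr1.
Qed.

Lemma ex_minimizer (T : Type) (P : T -> Prop) (f : T -> nat) :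
  (exists x, P x) -> exists2 x, P x & forall y, P y -> (f x <= f y)%N.
Proof.
move=> [x0 Px0].
have exn : exists n, `[< exists2 x, P x & f x = n >].
  by exists (f x0); apply/asboolP; exists x0.
case: (ex_minnP exn) => n /asboolP[x Px <-] nmin.
by exists x => // y Py; apply: nmin; apply/asboolP; exists y.
Qed.

(* Distances are integers, so that points at equal distances can be chosen
   exactly; this is what makes the constants independent of rounding. *)
Record hyp_action (R : realType) (G : groupType) (e : R) := HypAction {
  pt : Type;
  dn : pt -> pt -> nat;
  gact : G -> pt -> pt;
  e_ge0 : 0 <= e;
  dnxx : forall x, dn x x = 0%N;
  dnC : forall x y, dn x y = dn y x;
  dn_triangle : forall y x z, (dn x z <= dn x y + dn y z)%N;
  four_point : forall x y u v,
    (dn x y + dn u v)%:R <= (dn x u + dn y v)%:R + 2 * e \/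
    (dn x y + dn u v)%:R <= (dn x v + dn y u)%:R + 2 * e;
  dn_geodesic : forall u v, exists z : nat -> pt,
    [/\ z 0%N = u, z (dn u v) = v &
      forall i j, (i <= j <= dn u v)%N -> dn (z i) (z j) = (j - i)%N];
  gact1 : forall x, gact 1%g x = x;
  gactM : forall g h x, gact (g * h)%g x = gact g (gact h x);
  gact_isom : forall g x y, dn (gact g x) (gact g y) = dn x y
}.

(** * Gromov products and displacement along orbits *)

Section GromovProduct.
Variables (R : realType) (G : groupType) (e : R) (X : hyp_action G e).

Local Notation pt := (pt X).
Local Notation "g • x" := (gact g x) (at level 30, right associativity).

Implicit Types (x y z u v w p q : pt) (g h : G).

Definition dist x y : R := (dn x y)%:R.

Definition gp x y w : R := (dist w x + dist w y - dist x y) / 2.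

Lemma dist_ge0 x y : 0 <= dist x y. Proof. exact: ler0n. Qed.

Lemma distxx x : dist x x = 0. Proof. by rewrite /dist dnxx. Qed.

Lemma distC x y : dist x y = dist y x. Proof. by rewrite /dist dnC. Qed.

Lemma dist_triangle y x z : dist x z <= dist x y + dist y z.
Proof. by rewrite /dist -natrD ler_nat dn_triangle. Qed.

Lemma dist_act g x y : dist (g • x) (g • y) = dist x y.
Proof. by rewrite /dist gact_isom. Qed.

Lemma gactK g x : g^-1%g • g • x = x.
Proof. by rewrite -gactM mulVg gact1. Qed.

Lemma gactVK g x : g • g^-1%g • x = x.
Proof. by rewrite -gactM mulgV gact1. Qed.

Lemma dist_actl g x y : dist (g • x) y = dist x (g^-1%g • y).
Proof. by rewrite -(dist_act g^-1) gactK. Qed.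

Lemma dist_actr g x y : dist x (g • y) = dist (g^-1%g • x) y.
Proof. by rewrite -(dist_act g^-1) gactK. Qed.

Lemma dist4 x y u v :
  dist x y + dist u v <= dist x u + dist y v + 2 * e \/
  dist x y + dist u v <= dist x v + dist y u + 2 * e.
Proof.
by rewrite /dist; have := four_point x y u v; rewrite !natrD.
Qed.

Lemma gpC x y w : gp x y w = gp y x w.
Proof. by rewrite /gp (distC x y) [dist w x + _]addrC. Qed.

Lemma gp_act g x y w : gp (g • x) (g • y) (g • w) = gp x y w.
Proof. by rewrite /gp !dist_act. Qed.

Lemma gp_base g x y w : gp x y (g • w) = gp (g^-1%g • x) (g^-1%g • y) w.
Proof. by rewrite -(gp_act g^-1) gactK. Qed.

Lemma gp_ge0 x y w : 0 <= gp x y w.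
Proof. by rewrite /gp; have := dist_triangle w x y; rewrite (distC x w); lra. Qed.

Lemma gp_lel x y w : gp x y w <= dist w x.
Proof. by rewrite /gp; have := dist_triangle x w y; lra. Qed.

Lemma gpxw x w : gp x w w = 0.
Proof. by rewrite /gp distxx (distC x w); lra. Qed.

Lemma gp_shift x y w : gp x y w = dist w x - gp w y x.
Proof. by rewrite /gp (distC x w); lra. Qed.

Lemma gp4 y x z w : gp x y w <= gp x z w + e \/ gp y z w <= gp x z w + e.
Proof.
rewrite /gp; have [] := dist4 w y x z; rewrite ?(distC y x); move=> H.
  by right; lra.
by left; lra.
Qed.

(** One step along a broken path [p, w, q, z]: a small product at [q] makes the product of [q] and
    [z] at [w] large, which excludes one alternative of [gp4]. Only the bound at [w] is increased,
    so inductions keep fixed constants. *)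
Lemma chain_step c c' p q w z :
  gp p q w <= c -> gp w z q <= c' -> c + c' + e < dist w q -> gp p z w <= c + e.
Proof.
move=> pq wz dwq; have := gp4 z p q w; rewrite (gpC z q w) (gp_shift q).
by case=> ?; lra.
Qed.

Lemma commute_act g h x : commute g h -> g • h • x = h • g • x.
Proof. by move=> gh; rewrite -!gactM gh. Qed.

Lemma dist_commute g h x : commute g h -> dist (h • x) (g • h • x) = dist x (g • x).
Proof. by move=> gh; rewrite (commute_act _ gh) dist_act. Qed.

Lemma dist_pow g k x : dist x ((g ^+ k)%g • x) <= k%:R * dist x (g • x).
Proof.
elim: k => [|k IH]; first by rewrite expg0 gact1 distxx mul0r.
have := dist_triangle (g • x) x ((g ^+ k.+1)%g • x).
by rewrite expgS gactM dist_act -[k.+1%:R]natr1; lra.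
Qed.

(** Quasi-convexity of the displacement function: the four-point inequality for the pairs [w, g w]
    and [p, q]. *)
Lemma displacement p q w g :
  dist w (g • w) <= Num.max (dist p (g • p)) (dist q (g • q)) + 2 * gp p q w + 2 * e.
Proof.
have le_p : dist p (g • p) <= Num.max (dist p (g • p)) (dist q (g • q)).
  by rewrite le_max lexx.
have le_q : dist q (g • q) <= Num.max (dist p (g • p)) (dist q (g • q)).
  by rewrite le_max lexx orbT.
rewrite /gp; have := dist4 w (g • w) p q.
have := dist_triangle (g • p) p (g • w); rewrite dist_act.
have := dist_triangle (g • q) q (g • w); rewrite dist_act.
have := distC (g • w) p; have := distC (g • w) q; have := distC w p.
have := distC w q; set M := Num.max _ _ in le_p le_q *.
by move=> ? ? ? ? ? ? []; lra.
Qed.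

(** The nearby points [p] and [p'] see [w] and [w'] in the same direction, so the Busemann
    differences agree; [far] discards the other alternative of [dist4]. *)
Lemma busemann p p' w w' :
  dist p p' + e < gp w w' p ->
  dist p' w - dist p w <= dist p' w' - dist p w' + 2 * e.
Proof.
rewrite /gp => far.
have := dist4 p' w p w'; have := dist_triangle p' p w'.
have := dist_triangle p' p w; have := distC w p; have := distC p' p.
by move=> ? ? ? ? []; lra.
Qed.

(** Such points replace the axis of [g]; the minimum is attained because distances are integers. *)
Definition isMin g y := forall z, dist y (g • y) <= dist z (g • z).

Lemma isMinV g y : isMin g y -> isMin g^-1%g y.
Proof. by move=> My z; rewrite -!dist_actl distC (distC _ z). Qed.

Lemma ex_isMin g : inhabited pt -> exists y, isMin g y.
Proof.
move=> [x0].
have [|y _ ymin] := @ex_minimizer pt (fun=> True) (fun y => dn y (g • y)).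
  by exists x0.
by exists y => z; rewrite ler_nat ymin.
Qed.

(* The midpoint [z] of [g^-1 y] and [y] is moved at least as much as [y], which
   forbids backtracking at [y]. *)
Lemma min_gp g y : isMin g y -> 4 * e + 2 <= dist y (g • y) ->
  gp (g^-1%g • y) (g • y) y <= 2 * e.
Proof.
move=> My big; have [z [z0 zN zd]] := dn_geodesic (g^-1%g • y) y.
set N := dn _ _ in zN zd; have Ns : dist y (g • y) = N%:R by rewrite dist_actr.
set k := (N./2)%N; have kN : (k <= N)%N by rewrite /k; lia.
have d1 : dist (g^-1%g • y) (z k) = k%:R by rewrite /dist -z0 zd ?subn0 ?kN.
have d2 : dist (z k) y = N%:R - k%:R.
  by rewrite /dist -{1}zN zd ?kN ?leqnn // natrB.
have d3 : dist y (g • z k) = k%:R by rewrite dist_actr.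
have d4 : dist (g • z k) (g • y) = N%:R - k%:R by rewrite dist_act.
have d5 := My (z k).
have k2 : (N%:R - 1) / 2 <= k%:R :> R.
  have : (N <= k.*2 + 1)%N by rewrite /k; lia.
  by rewrite -(ler_nat R) natrD -muln2 natrM; lra.
have k3 : k%:R <= N%:R / 2 :> R.
  have : (k.*2 <= N)%N by rewrite /k; lia.
  by rewrite -(ler_nat R) -muln2 natrM; lra.
have := gp4 (g^-1%g • y) (z k) (g • y) y.
have := gp4 (g • y) (z k) (g • z k) y.
have := distC y (z k); have := distC y (g^-1%g • y); have := distC (z k) (g^-1%g • y).
have := distC (g • y) (g • z k).
have : dist (g^-1%g • y) y = N%:R by [].
have := e_ge0 X.
by rewrite /gp; lra.
Qed.

(** The turn at [y] is at most [2 * e] by [min_gp]; the induction hypothesis, translated by [g],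
    bounds the turn at [g y], and [chain_step] adds [e] to the former only. *)
Lemma orbit_gp1 g y k : isMin g y -> 100 * (e + 1) <= dist y (g • y) ->
  gp (g^-1%g • y) ((g ^+ k)%g • y) y <= 3 * e.
Proof.
move=> My big; have e0 := e_ge0 X.
elim: k => [|k IH]; first by rewrite expg0 gact1 gpxw; lra.
have -> : 3 * e = 2 * e + e by lra.
apply: (@chain_step _ (3 * e) _ (g • y)); last 1 first.
- by lra.
- by apply: min_gp => //; lra.
- by rewrite expgS gactM gp_base gactK.
Qed.

Lemma orbit_dist g y k : isMin g y -> 100 * (e + 1) <= dist y (g • y) ->
  k%:R * (dist y (g • y) - 6 * e) <= dist y ((g ^+ k)%g • y).
Proof.
move=> My big; have e0 := e_ge0 X.
elim: k => [|k IH]; first by rewrite mul0r dist_ge0.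
have := orbit_gp1 k My big; rewrite -(gp_act g) gactVK -gactM -expgS /gp.
rewrite [dist (g • y) y]distC (expgS g k) gactM dist_act -[k.+1%:R]natr1; lra.
Qed.

Lemma orbit_gp g y j k : isMin g y -> 100 * (e + 1) <= dist y (g • y) ->
  gp ((g^-1 ^+ j)%g • y) ((g ^+ k)%g • y) y <= 4 * e.
Proof.
move=> My big; have e0 := e_ge0 X.
have MyV := isMinV My.
have bigV : 100 * (e + 1) <= dist y (g^-1%g • y) by rewrite -dist_actl distC.
case: j => [|j]; first by rewrite expg0 gact1 gpC gpxw; lra.
rewrite gpC; have -> : 4 * e = 3 * e + e by lra.
apply: (@chain_step _ (3 * e) _ (g^-1%g • y)); last 1 first.
- by lra.
- by rewrite gpC; exact: orbit_gp1.
by rewrite expgS gactM gp_base gactK; exact: orbit_gp1.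
Qed.

Lemma orbit_unbounded g y C : isMin g y -> 100 * (e + 1) <= dist y (g • y) ->
  exists k, C < dist y ((g ^+ k)%g • y).
Proof.
move=> My big; have e0 := e_ge0 X.
exists (Num.truncn C).+1; apply: lt_le_trans (orbit_dist _ My big).
have := truncnS_gt C; set N : R := _%:R => CN.
have N0 : 0 <= N by exact: ler0n.
have : N * 1 <= N * (dist y (g • y) - 6 * e) by apply: ler_wpM2l => //; lra.
by lra.
Qed.

Lemma dist_orbitV g y k : dist y ((g^-1 ^+ k)%g • y) = dist y ((g ^+ k)%g • y).
Proof. by rewrite expVgn -dist_actl distC. Qed.

(** The element [(g ^+ i) ^+ (n * N)] is also [(g ^+ n) ^+ (i * N)]. Its displacement is bounded
    above through [u] and below through [y]; letting [N] grow removes the distance between the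
    two. *)
Lemma root_dist_ge g n y u i : isMin (g ^+ n)%g y ->
  100 * (e + 1) <= dist y ((g ^+ n)%g • y) ->
  i%:R * (dist y ((g ^+ n)%g • y) - 6 * e) <= n%:R * dist u ((g ^+ i)%g • u).
Proof.
move=> My big; apply: (@archi_le _ _ _ (2 * dist y u)) => N.
have := orbit_dist (i * N) My big.
have := dist_pow (g ^+ i)%g (n * N) u.
have -> : ((g ^+ i) ^+ (n * N) = (g ^+ n) ^+ (i * N))%g.
  by rewrite -!expgnA; congr (g ^+ _)%g; lia.
set h := ((g ^+ n) ^+ _)%g; rewrite !natrM.
have := dist_triangle u y (h • y); have := dist_triangle (h • u) u (h • y).
rewrite dist_act (distC u y).
set a := dist _ _; set b := dist _ _; set c := dist _ _; set s := dist _ _.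
set N' : R := N%:R; set i' : R := i%:R; set n' : R := n%:R.
by lra.
Qed.

(* [h -> dist y p - dist (h y) p] is a quasimorphism on elements that move the
   far away point [p] as little as [y]. *)
Lemma superadditive h p y n :
  dist p (h • p) = dist y (h • y) ->
  (n + 1)%:R * dist y (h • y) + e < dist y p ->
  n%:R * (dist y p - dist (h • y) p - 2 * e) <= dist y p - dist ((h ^+ n)%g • y) p.
Proof.
move=> hp; elim: n => [|n IH]; first by rewrite mul0r expg0 gact1 subrr.
rewrite !natrD -[n.+1%:R]natr1 => far.
have d0 := dist_ge0 y (h • y).
have /IH {}IH : (n + 1)%:R * dist y (h • y) + e < dist y p.
  by apply: le_lt_trans far; rewrite natrD; lra.
have := dist_pow h n y.
have hu : (h ^+ n.+1)%g • y = h • (h ^+ n)%g • y by rewrite expgS gactM.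
rewrite hu !(dist_actl h).
set u := (h ^+ n)%g • y in IH *.
set p' := h^-1%g • p => dyu.
have pp' : dist p p' = dist y (h • y) by rewrite /p' -dist_actl distC.
have := @busemann p p' u y.
rewrite /gp pp' !(distC p') !(distC p).
have := dist_triangle u y p; rewrite (distC u y).
rewrite !(dist_actl h) -/p' in IH.
have n0 : 0 <= n%:R :> R by exact: ler0n.
have e0 := e_ge0 X.
set a := dist _ _ in dyu IH *.
move: (dist y p) (dist u p) (dist u p') (dist y p') IH far => *.
by lra.
Qed.

End GromovProduct.

(** * Acylindrical actions *)

Section Acylindricity.
Variables (R : realType) (G : groupType) (e : R) (X : hyp_action G e).

Local Notation pt := (pt X).
Local Notation "g • x" := (gact g x) (at level 30, right associativity).

Implicit Types (x y z u v w p q : pt) (g h : G).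

(** Each end is replaced at the cost of one [e], since it moves much less than its distance to
    [w]. *)
Lemma gp_perturb p q p' q' w c : gp p q w <= c ->
  c + 2 * e + dist p p' < dist w p -> c + 2 * e + dist q q' < dist w q ->
  gp p' q' w <= c + 2 * e.
Proof.
move=> pq fp fq; have e0 := e_ge0 X.
have pp' : dist w p - dist p p' <= gp p' p w.
  by rewrite gpC /gp; have := dist_triangle p' w p; rewrite (distC p' p); lra.
have qq' : dist w q - dist q q' <= gp q' q w.
  by rewrite gpC /gp; have := dist_triangle q' w q; rewrite (distC q' q); lra.
rewrite gpC in pp'; rewrite gpC in qq'.
have [|p'q] := gp4 p' p q w; first by lra.
by have [|] := gp4 q' p' q w; rewrite 1?(gpC q' q); lra.
Qed.

Lemma gp_perturb_act h p q w d : gp p q w = 0 ->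
  dist p (h • p) <= d -> dist q (h • q) <= d ->
  2 * e + d < dist w p -> 2 * e + d < dist w q ->
  gp p q (h • w) <= 2 * e.
Proof.
move=> pqw dp dq wp wq; have -> : 2 * e = 0 + 2 * e by lra.
apply: (@gp_perturb (h • p) (h • q)); rewrite ?gp_act ?pqw //.
- by rewrite dist_act (distC (h • p)); lra.
- by rewrite dist_act (distC (h • q)); lra.
Qed.

(** Along a geodesic the distance to one end is a coordinate. Being an integer, it can label images
    of a point, and equal labels mean distance at most [6 * e]. *)
Lemma dist_on_line p q w w' : gp p q w <= 2 * e -> gp p q w' <= 2 * e ->
  dist w w' <= `|dist p w - dist p w'| + 6 * e.
Proof.
rewrite /gp => pw pw'.
have := ler_norm (dist p w - dist p w').
have := lerNnormlW (lexx `|dist p w - dist p w'|).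
have := dist4 w w' p q.
have := dist_triangle w p q; have := dist_triangle w' p q.
have := distC w p; have := distC w' p.
by move=> ? ? ? ? []; lra.
Qed.

(** An element commuting with [g] moves all points of an orbit of [g] equally, so it carries a long
    piece of the axis close to itself. *)
Lemma near_axis h g y k : commute h g -> isMin g y ->
  100 * (e + 1) <= dist y (g • y) -> dist y (h • y) + 6 * e < dist y ((g ^+ k)%g • y) ->
  gp ((g^-1 ^+ k)%g • y) ((g ^+ k)%g • y) (h • y) <= 6 * e.
Proof.
move=> hg My big far; have -> : 6 * e = 4 * e + 2 * e by lra.
apply: (@gp_perturb (h • (g^-1 ^+ k)%g • y) (h • (g ^+ k)%g • y)).
- by rewrite gp_act; exact: orbit_gp.
- rewrite dist_act dist_orbitV (distC (h • _)) dist_commute; first by lra.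
  by apply/commuteX/commuteV.
- rewrite dist_act (distC (h • _)) dist_commute; first by lra.
  exact/commuteX.
Qed.

(* Superadditivity towards both ends of the axis; since [g^i y] is close to the
   axis, one of the two Busemann differences is almost [dist y (g^i y)]. *)
Lemma root_dist_le g n y i : (0 < n)%N -> isMin (g ^+ n)%g y ->
  100 * (e + 1) <= dist y ((g ^+ n)%g • y) ->
  n%:R * dist y ((g ^+ i)%g • y) <=
    i%:R * dist y ((g ^+ n)%g • y) + 24 * e * n%:R.
Proof.
move=> n0 My big; have e0 := e_ge0 X.
set h := (g ^+ i)%g; set t := (g ^+ n)%g in My big *.
have ht : commute h t by apply: commuteX2.
set C := (n + 1)%:R * dist y (h • y) + 6 * e.
have [k far] := orbit_unbounded C My big.
have d0 := dist_ge0 y (h • y).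
have n1 : 1 <= n%:R :> R by rewrite (ler_nat _ 1).
have htn : (h ^+ n = t ^+ i)%g by rewrite /h /t -!expgnA mulnC.
have far' : dist y (h • y) + 6 * e < dist y ((t ^+ k)%g • y).
  apply: le_lt_trans far; rewrite /C natrD.
  have : 0 <= n%:R * dist y (h • y) by rewrite mulr_ge0.
  by lra.
have near := near_axis ht My big far'.
have Eplus : dist ((t ^+ k)%g • y) (h • (t ^+ k)%g • y) = dist y (h • y).
  by rewrite dist_commute //; apply/commuteX.
have Eminus : dist ((t^-1 ^+ k)%g • y) (h • (t^-1 ^+ k)%g • y) = dist y (h • y).
  by rewrite dist_commute //; apply/commuteX/commuteV.
have Dminus := dist_orbitV t y k.
have plus := superadditive (n := n) Eplus; have minus := superadditive (n := n) Eminus.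
rewrite /C in far; rewrite htn in plus minus.
have {}/plus plus : (n + 1)%:R * dist y (h • y) + e < dist y ((t ^+ k)%g • y) by lra.
have {}/minus minus : (n + 1)%:R * dist y (h • y) + e < dist y ((t^-1 ^+ k)%g • y) by lra.
have := orbit_gp k i My big; have := dist_pow t i y.
have := dist4 y (h • y) ((t ^+ k)%g • y) ((t^-1 ^+ k)%g • y).
move: near plus minus.
set p := (t ^+ k)%g • y; set p' := (t^-1 ^+ k)%g • y; set v := (t ^+ i)%g • y.
have := dist_triangle v y p; rewrite /gp (distC p' v) (distC p' p).
set s := dist y (t • y); set dh := dist y (h • y).
set hp := dist (h • y) p; set hp' := dist (h • y) p'.
move=> tri near plus minus d4 vs gpv.
have ne : e <= n%:R * e by rewrite ler_peMl.
(* Twice the bound [6 * e] on the product at [h y], plus the [2 * e] of [dist4]. *)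
have [le_dh|le_dh] : dh <= dist y p - hp + 14 * e \/ dh <= dist y p' - hp' + 14 * e.
  by case: d4 => ?; [left|right]; lra.
- have : n%:R * dh <= n%:R * (dist y p - hp + 14 * e) by rewrite ler_wpM2l // ler0n.
  by move: tri vs plus; set a := dist y v; set b := dist v p; lra.
(* Here [h] would move [y] towards [p'], whereas [h ^+ n = t ^+ i] does not: by [gpv] it gains at
   most [8 * e] in that direction. With the [16 * e] lost in each of the [n] steps this gives the
   [24]. *)
- have : n%:R * dh <= n%:R * (dist y p' - hp' + 14 * e) by rewrite ler_wpM2l // ler0n.
  have is0 : 0 <= i%:R * s by rewrite mulr_ge0 ?ler0n // dist_ge0.
  have yv0 := dist_ge0 y v.
  by move: gpv minus; set a := dist y v in yv0 *; set b := dist v p'; lra.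
Qed.

(* [6 * e] is [18 * delta] for a graph: below the available [20 * delta]. *)
Definition acyl (K L : R) := forall x y, L <= dist x y -> forall s : seq G,
  uniq s -> (forall g, g \in s -> dist x (g • x) <= 6 * e /\ dist y (g • y) <= 6 * e) ->
  (size s)%:R <= K.

(* [K] times the number of classes: two integers in an interval of radius about
   [D] and a color. *)
Definition acyl_bound (K D : R) : R := ((2 * Num.truncn D + 3) ^ 2 * 2)%:R * K.

Lemma pigeonhole_sum (K : R) (T : finType) (n : nat) (F : 'I_n -> T) :
  (forall t, #|[pred i | F i == t]|%:R <= K) -> n%:R <= #|T|%:R * K.
Proof.
move=> fib; have -> : n = (\sum_(t : T) #|[pred i | F i == t]|)%N.
  rewrite -[LHS]card_ord -sum1_card (partition_big F xpredT) //=.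
  by apply: eq_bigr => t _; rewrite -sum1_card.
rewrite natr_sum mulr_natl -sumr_const.
by apply: ler_sum => t _.
Qed.

(** Acylindricity is tested at [u'] and [v'], at depth more than [D + 2 * e] inside the segment from
    [u] to [v], where images under all [f i] stay close to it. The color lets a caller demand that
    the repeated value come from the same choice of sign. *)
Lemma acyl_pigeonhole K L D u v (f : nat -> G) (col : nat -> bool) (n : nat) :
  acyl K L -> 0 <= L -> 0 <= D -> L + 2 * D + 4 * e + 2 <= dist u v ->
  (forall i, (i < n)%N -> dist u (f i • u) <= D /\ dist v (f i • v) <= D) ->
  acyl_bound K D < n%:R ->
  exists i j, [/\ (i < j)%N, col i = col j & f i = f j].
Proof.
move=> acy L0 D0 far small nbig; have e0 := e_ge0 X.
have De0 : 0 <= D + 2 * e by lra.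
have [k kgt kle] := ex_nat_above De0.
have [Dn Dlt DnE] : exists2 Dn : nat, D < Dn%:R & Dn = (Num.truncn D).+1.
  by exists (Num.truncn D).+1 => //; exact: truncnS_gt.
have [z [z0 zN zd]] := dn_geodesic u v; set N := dn u v in zN zd.
have Nuv : dist u v = N%:R by [].
have kN : (k + k <= N)%N by rewrite -(ler_nat R) natrD; lra.
have zdR i j : (i <= j)%N -> (j <= N)%N -> dist (z i) (z j) = j%:R - i%:R.
  by move=> ij jN; rewrite /dist zd ?ij // natrB.
have kN1 : (k <= N)%N by apply: leq_trans (leq_addr k k) kN.
have kN2 : (k <= N - k)%N by rewrite leq_subRL.
have kN' : k%:R + k%:R <= N%:R :> R by rewrite -natrD ler_nat.
set u' := z k; set v' := z (N - k)%N.
have uu' : dist u u' = k%:R by rewrite -{1}z0 zdR // subr0.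
have vv' : dist v v' = k%:R.
  by rewrite distC -{1}zN zdR ?leq_subr // natrB //; lra.
have uv' : dist u v' = N%:R - k%:R by rewrite -{1}z0 zdR ?leq_subr // natrB ?subr0.
have vu' : dist v u' = N%:R - k%:R by rewrite distC -{1}zN zdR.
have u'v' : L <= dist u' v'.
  by rewrite zdR ?leq_subr // natrB //; lra.
have gu' : gp u v u' = 0 by rewrite /gp distC (distC u') uu' vu' Nuv; lra.
have gv' : gp u v v' = 0 by rewrite /gp distC (distC v') uv' vv' Nuv; lra.
have on_line i : (i < n)%N ->
    gp u v (f i • u') <= 2 * e /\ gp u v (f i • v') <= 2 * e.
  move=> /small[su sv]; split; apply: gp_perturb_act su sv _ _ => //.
  - by rewrite distC uu'; lra.
  - by rewrite distC vu'; lra.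
  - by rewrite distC uv'; lra.
  - by rewrite distC vv'; lra.
(* The distance from [u] changes by at most [D < Dn], so with [b] the original distance the shifted
   difference is a true subtraction and fits in the window. *)
pose code (a b : nat) : 'I_(2 * Dn).+1 := inord (a + Dn - b).
have code_inj w m i j : dist u w = m%:R -> (i < n)%N -> (j < n)%N ->
    code (dn u (f i • w)) m = code (dn u (f j • w)) m ->
    dist u (f i • w) = dist u (f j • w).
  move=> uw; have near l : (l < n)%N ->
      (m <= dn u (f l • w) + Dn)%N /\ (dn u (f l • w) <= m + Dn)%N.
    move=> /small[su _]; rewrite -!(ler_nat R) !natrD -uw.
    have := dist_triangle (f l • u) u (f l • w).
    have := dist_triangle u (f l • u) (f l • w).
    rewrite !dist_act (distC (f l • u)) uw -/(dist u (f l • w)) => ? ?.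
    by split; lra.
  move=> /near[i1 i2] /near[j1 j2] /(congr1 val) /=.
  rewrite /dist !inordK; last 2 first.
  - by clear -j1 j2; lia.
  - by clear -i1 i2; lia.
  by move=> eqc; congr _%:R; clear -i1 i2 j1 j2 eqc; lia.
pose F (i : 'I_n) := (code (dn u (f i • u')) k, code (dn u (f i • v')) (N - k)%N, col i).
apply: contrapT => nex.
have f_inj (i j : 'I_n) : col i = col j -> f i = f j -> i = j.
  move=> cij fij; have [ij|ji|/val_inj //] := ltngtP (val i) (val j).
    by case: nex; exists (val i), (val j).
  by case: nex; exists (val j), (val i).
have K0 : 0 <= K.
  by have := acy u v _ [::] isT; apply => //; lra.
suff : n%:R <= #|{: 'I_(2 * Dn).+1 * 'I_(2 * Dn).+1 * bool}|%:R * K.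
  rewrite !card_prod !card_ord card_bool leNgt => /negP; apply.
  rewrite (_ : (2 * Dn).+1 = 2 * Num.truncn D + 3)%N; last by rewrite DnE; clear; lia.
  by rewrite mulnn.
apply: (@pigeonhole_sum _ _ _ F) => t; set A := [pred i | _].
have [i0 Ai0|A0] := pickP A; last by rewrite eq_card0.
set s := [seq (f i0)^-1 * f (val i) | i <- enum A]%g.
have As i : i \in enum A -> F i = F i0.
  by rewrite mem_enum => /eqP ->; exact/esym/eqP.
have -> : #|A| = size s by rewrite size_map cardE.
apply: acy u'v' _ _ _.
  rewrite map_inj_in_uniq ?enum_uniq // => i j /As Fi /As Fj /mulgI.
  by apply: f_inj; have := congr1 snd Fi; rewrite /= => ->; have := congr1 snd Fj.
move=> g /mapP[i /As [cu cv _] ->].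
have [li lv] := on_line _ (ltn_ord i); have [li0 lv0] := on_line _ (ltn_ord i0).
rewrite !gactM -!dist_actl; split.
  have := dist_on_line li0 li; rewrite (code_inj _ _ _ _ _ _ _ cu) ?ltn_ord //.
  by rewrite subrr normr0 add0r.
have := dist_on_line lv0 lv; rewrite (code_inj _ _ _ _ _ _ _ cv) ?ltn_ord //.
  by rewrite subrr normr0 add0r.
by rewrite uv' natrB.
Qed.

End Acylindricity.

(** * Translation lengths and overlaps of axes *)

Section Displacement.
Variables (R : realType) (G : groupType) (e : R) (X : hyp_action G e).

Local Notation pt := (pt X).
Local Notation "g • x" := (gact g x) (at level 30, right associativity).

Implicit Types (x y z u v w p q : pt) (g h : G).

Definition loxodromic g := exists y (c C : R), 0 < c /\
  forall k, k%:R * c - C <= dist y ((g ^+ k)%g • y).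

(** Applying the linear bound to the powers of [g ^+ k] and dividing by the exponent removes both
    the base point and the additive constant. *)
Lemma loxodromic_dist g : loxodromic g ->
  exists2 c : R, 0 < c & forall u k, k%:R * c <= dist u ((g ^+ k)%g • u).
Proof.
move=> [y [c [C [c0 yk]]]]; exists c => // u k.
apply: (@archi_le _ _ _ (C + 2 * dist u y)) => N.
have := yk (k * N)%N; have := dist_pow (g ^+ k)%g N u; rewrite -expgnA.
set h := (g ^+ (k * N))%g; rewrite natrM.
have := dist_triangle u y (h • y); have := dist_triangle (h • u) u (h • y).
rewrite dist_act (distC y u).
set N' : R := N%:R; set k' : R := k%:R.
by move: (dist _ _) (dist _ _) (dist _ _) (dist _ _) => *; lra.
Qed.

Lemma loxodromic_expg_inj g i j : loxodromic g -> (i < j)%N -> (g ^+ i <> g ^+ j)%g.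
Proof.
move=> lg ij eg; have [c c0 gc] := loxodromic_dist lg.
have [y _] := lg; have := gc y (j - i)%N.
rewrite expgnFr ?(ltnW ij) // -eg mulgV gact1 distxx.
rewrite leNgt mulr_gt0 // ltr0n subn_gt0 //.
Qed.

(* If [g ^+ n] moved some point by less than [B], the first [n] powers of [g]
   would move two far apart points of the axis by a bounded amount. *)
Lemma loxodromic_power_displacement K L B g n x :
  acyl X K L -> 0 <= L -> 0 <= B -> loxodromic g ->
  acyl_bound K (B + 24 * e) < n%:R -> (0 < n)%N -> B <= dist x ((g ^+ n)%g • x).
Proof.
move=> acy L0 B0 lg nbig n0; have e0 := e_ge0 X.
rewrite leNgt; apply/negP => small.
have [c c0 gc] := loxodromic_dist lg.
set D := B + 24 * e in nbig; set T := 100 * (e + 1) + (L + 2 * D + 4 * e + 2).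
have [q qT] : exists q : nat, T <= q%:R * c.
  exists (Num.truncn (T / c)).+1; rewrite -ler_pdivrMr //.
  exact/ltW/truncnS_gt.
(* The power [q] makes the axis long enough for acylindricity, while [t] moves its minimal point [y]
   by at most [q * B]. Hence [root_dist_le] bounds the displacement of [y] under [g ^+ i], for
   [i < n], by [B + 24 * e]. *)
set N := (n * q)%N; set t := (g ^+ N)%g.
have [y My] := ex_isMin t (inhabits x).
have n1 : 1 <= n%:R :> R by rewrite (ler_nat _ 1).
have q0 : 0 <= q%:R :> R by exact: ler0n.
have sT : T <= dist y (t • y).
  apply: le_trans (gc y N); rewrite /N natrM -mulrA.
  by apply: le_trans qT _; rewrite ler_peMl // mulr_ge0 // ltW.
have D0 : 0 <= D by rewrite /D; lra.
have big : 100 * (e + 1) <= dist y (t • y) by rewrite /T in sT; lra.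
have far : L + 2 * D + 4 * e + 2 <= dist y (t • y) by rewrite /T in sT; lra.
have N0 : (0 < N)%N.
  rewrite /N muln_gt0 n0 lt0n; apply/negP => /eqP q00.
  by move: qT; rewrite q00 mul0r /T; lra.
have sB : dist y (t • y) <= q%:R * B.
  apply: le_trans (My x) _; rewrite /t /N expgnA.
  apply: le_trans (dist_pow _ _ _) _; apply: ler_wpM2l => //; exact: ltW.
have disp i : (i < n)%N -> dist y ((g ^+ i)%g • y) <= D.
  move=> ltin; have := root_dist_le i N0 My big; rewrite -/t => le.
  have NR : 0 < N%:R :> R by rewrite ltr0n.
  rewrite -(ler_pM2l NR); apply: le_trans le _.
  have : i%:R * dist y (t • y) <= n%:R * (q%:R * B).
    by apply: ler_pM => //; rewrite ?dist_ge0 // ler_nat ltnW.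
  by rewrite /D /N natrM; lra.
have [|i [j [ij _ eqg]]] := acyl_pigeonhole (f := fun i => (g ^+ i)%g)
    (fun=> true) acy L0 D0 far _ nbig.
  move=> i ltin; rewrite dist_commute; first by split; exact: disp.
  by rewrite /t; apply: commuteX2.
exact: loxodromic_expg_inj ij eqg.
Qed.

Definition signed g (s : bool) : G := if s then g else g^-1%g.

Section Translations.
Variables (p p' u v : pt) (t r : R).

(** The [30] is [24] for a root at a point of the axis, plus [4 + 2] from [displacement] at a point
    whose product is at most [2 * e]; the [6] is the loss in [root_displacement_ge]. *)
Definition translation h :=
  [/\ dist p (h • p) <= r, dist p' (h • p') <= r,
      dist u (h • u) <= t + 30 * e & t - 6 * e <= dist u (h • u)].

(** The third clause puts [u] between [p] and [v]. The margin keeps [u], [v] and their images beyond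
    everything that happens near the two ends. *)
Definition deep := [/\ gp p p' u = 0, gp p p' v = 0, gp u v p = dist p u,
   r + t + 40 * e < dist p u & [/\ r + t + 40 * e < dist p v,
   r + t + 40 * e < dist p' u & r + t + 40 * e < dist p' v]].

Lemma translationV h : translation h -> translation h^-1%g.
Proof.
by case=> *; split; rewrite -dist_actl distC.
Qed.

Lemma translation_line h w : deep -> 0 <= r -> 0 <= t -> translation h ->
  w = u \/ w = v -> gp p p' (h • w) <= 2 * e.
Proof.
have e0 := e_ge0 X.
move=> [pu pv _ fpu [fpv fp'u fp'v]] r0 t0 [hp hp' _ _] [] ->.
  by apply: (gp_perturb_act pu hp hp'); rewrite distC; lra.
by apply: (gp_perturb_act pv hp hp'); rewrite distC; lra.
Qed.

Let shift h w := dist p (h • w) - dist p w.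

(** The shift at [w] is the difference of distances from [w] to [h^-1 p] and to [p], a Busemann
    difference, almost the same for all deep [w]. *)
Lemma translation_shift_uv h : deep -> 0 <= r -> 0 <= t -> translation h ->
  shift h u <= shift h v + 2 * e /\ shift h v <= shift h u + 2 * e.
Proof.
have e0 := e_ge0 X.
move=> [_ _ uv far _] r0 t0 [hp _ _ _]; rewrite /shift !(dist_actr h).
have pV : dist p (h^-1%g • p) <= r by rewrite -dist_actl distC.
by split; apply: busemann; rewrite 1?(gpC v) uv; lra.
Qed.

(** The Busemann difference of [h^-1 p] and [p] is [shift h u] at [u] and minus [shift h^-1 u] at
    [h^-1 u]. *)
Lemma translation_shift_inv h : deep -> 0 <= r -> 0 <= t -> translation h ->
  shift h^-1%g u <= - shift h u + 2 * e /\ - shift h u <= shift h^-1%g u + 2 * e.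
Proof.
have e0 := e_ge0 X.
move=> [_ _ uv far _] r0 t0 [hp _ hu _]; rewrite /shift.
have pV : dist p (h^-1%g • p) <= r by rewrite -dist_actl distC.
have uV : dist u (h^-1%g • u) <= t + 30 * e by rewrite -dist_actl distC.
have gpu : dist p u - (t + 30 * e) <= gp u (h^-1%g • u) p.
  by rewrite /gp; have := dist_triangle (h^-1%g • u) p u; rewrite (distC (h^-1%g • u) u); lra.
have E1 : dist (h^-1%g • p) u = dist p (h • u) by rewrite dist_actr.
have E2 : dist (h^-1%g • p) (h^-1%g • u) = dist p u by rewrite dist_act.
have := busemann (p := p) (p' := h^-1%g • p) (w := u) (w' := h^-1%g • u).
have := busemann (p := p) (p' := h^-1%g • p) (w := h^-1%g • u) (w' := u).
rewrite E1 E2 (gpC (h^-1%g • u)) => b1 b2.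
have fargp : dist p (h^-1%g • p) + e < gp u (h^-1%g • u) p by lra.
by have := b1 fargp; have := b2 fargp; split; lra.
Qed.

Lemma translation_shift_abs h : deep -> 0 <= r -> 0 <= t -> translation h ->
  [/\ shift h u <= t + 30 * e, - shift h u <= t + 30 * e &
      t - 12 * e <= shift h u \/ shift h u <= 12 * e - t].
Proof.
have e0 := e_ge0 X.
move=> D r0 t0 H; have [pu _ _ _ _] := D; have [_ _ hu1 hu2] := H.
have line : gp p p' (h • u) <= 2 * e by apply: translation_line => //; left.
have lineu : gp p p' u <= 2 * e by lra.
have := dist_on_line lineu line.
have := dist_triangle u p (h • u); have := dist_triangle (h • u) p u.
rewrite /shift (distC (h • u) u).
have [le0|le0] := lerP 0 (dist p u - dist p (h • u)).
  by rewrite ger0_norm //; split; try lra; right; lra.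
by rewrite ltr0_norm //; split; try lra; left; lra.
Qed.

(* [h] and [k] may translate the line from [p] to [p'] in opposite directions,
   whence the sign. *)
Lemma translations_agree h k : deep -> 0 <= r -> 0 <= t ->
  translation h -> translation k ->
  exists s, dist (h • u) (signed k s • u) <= 54 * e /\
            dist (h • v) (signed k s • v) <= 54 * e.
Proof.
move=> D r0 t0 H K; have e0 := e_ge0 X; have KV := translationV K.
have [h1 h2 h3] := translation_shift_abs D r0 t0 H.
have [k1 k2 k3] := translation_shift_abs D r0 t0 K.
have [h4 h5] := translation_shift_uv D r0 t0 H.
(* Shifts of the same sign differ by at most [42 * e], and inverting [k] costs [2 * e]. Passing from
   [u] to [v] costs [2 * e] for each element, and [dist_on_line] adds [6 * e], whence [54]. *)
have conclude k' : translation k' -> shift h u <= shift k' u + 44 * e ->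
    shift k' u <= shift h u + 44 * e ->
    dist (h • u) (k' • u) <= 54 * e /\ dist (h • v) (k' • v) <= 54 * e.
  move=> K' le1 le2.
  have [k4 k5] := translation_shift_uv D r0 t0 K'.
  have hu := translation_line D r0 t0 H (or_introl erefl).
  have hv := translation_line D r0 t0 H (or_intror erefl).
  have ku := translation_line D r0 t0 K' (or_introl erefl).
  have kv := translation_line D r0 t0 K' (or_intror erefl).
  have := dist_on_line hu ku; have := dist_on_line hv kv.
  rewrite /shift in le1 le2 h4 h5 k4 k5 => Dv Du.
  have Nu : `|dist p (h • u) - dist p (k' • u)| <= 48 * e.
    by rewrite ler_norml; apply/andP; split; lra.
  have Nv : `|dist p (h • v) - dist p (k' • v)| <= 48 * e.
    by rewrite ler_norml; apply/andP; split; lra.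
  by split; lra.
have [k6 k7] := translation_shift_inv D r0 t0 K.
case: h3 => h3; case: k3 => k3.
- by exists true; apply: conclude => //=; lra.
- by exists false; apply: conclude => //=; lra.
- by exists false; apply: conclude => //=; lra.
- by exists true; apply: conclude => //=; lra.
Qed.

End Translations.

End Displacement.

(** * Powers of an element and of its conjugate along a common line *)

Section Overlap.
Variables (R : realType) (G : groupType) (e : R) (X : hyp_action G e).

Local Notation pt := (pt X).
Local Notation "g • x" := (gact g x) (at level 30, right associativity).

Implicit Types (x y z u v w p q : pt) (g h : G).

Lemma root_displacement_le g n y i : (0 < n)%N -> isMin (g ^+ n)%g y ->
  100 * (e + 1) <= dist y ((g ^+ n)%g • y) ->
  dist y ((g ^+ i)%g • y) <= i%:R * (dist y ((g ^+ n)%g • y) / n%:R) + 24 * e.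
Proof.
move=> n0 My big; have upper := root_dist_le i n0 My big.
have nR : 0 < n%:R :> R by rewrite ltr0n.
rewrite -(ler_pM2l nR); apply: le_trans upper _.
rewrite le_eqVlt; apply/orP; left; apply/eqP; field.
by rewrite lt0r_neq0.
Qed.

Lemma root_displacement_ge g n y u i : (0 < n)%N -> (i <= n)%N -> isMin (g ^+ n)%g y ->
  100 * (e + 1) <= dist y ((g ^+ n)%g • y) ->
  i%:R * (dist y ((g ^+ n)%g • y) / n%:R) - 6 * e <= dist u ((g ^+ i)%g • u).
Proof.
move=> n0 lein My big; have lower := root_dist_ge u i My big; have e0 := e_ge0 X.
set s := dist y _ in lower *.
have nR : 0 < n%:R :> R by rewrite ltr0n.
rewrite -(ler_pM2l nR); apply: le_trans lower.
have : i%:R * e <= n%:R * e by rewrite ler_wpM2r // ler_nat.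
have -> : n%:R * (i%:R * (s / n%:R) - 6 * e) = i%:R * s - 6 * (n%:R * e).
  by field; rewrite lt0r_neq0.
by lra.
Qed.

Lemma isMin_displacement g y z : isMin g y -> isMin g z -> dist z (g • z) = dist y (g • y).
Proof. by move=> My Mz; apply/eqP; rewrite eq_le My Mz. Qed.

Lemma conj_expg g h k : ((g * h * g^-1) ^+ k = g * h ^+ k * g^-1)%g.
Proof.
elim: k => [|k IH]; first by rewrite !expg0 mulg1 mulgV.
by rewrite !expgS IH !mulgA mulgVK.
Qed.

Lemma expg_ratioE g h i j : (i <= j)%N ->
  ((g ^+ i)^-1 * h ^+ i = (g ^+ j)^-1 * h ^+ j)%g -> (g ^+ (j - i) = h ^+ (j - i))%g.
Proof.
move=> lij E; rewrite !expgnFr //.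
have := congr1 (fun t : G => g ^+ j * t / h ^+ i)%g E.
by rewrite !mulgA mulgV mul1g mulgK => <-.
Qed.

Lemma expg_prodE g h i j : (i <= j)%N ->
  (g ^+ i * h ^+ i = g ^+ j * h ^+ j)%g -> (g ^+ (j - i) = (h ^+ (j - i))^-1)%g.
Proof.
move=> lij E; rewrite !expgnFr // invgF.
have := congr1 (fun t : G => (g ^+ i)^-1 * t / h ^+ j)%g E.
rewrite !mulgA mulVg mul1g mulgK => ->.
have gC : commute (g ^+ j)%g (g ^+ i)^-1%g by apply/commuteV/commuteX2.
exact: gC.
Qed.

(** For [i < Q], both [a ^+ i] and the conjugate [c ^+ i] translate the line from [p] to [p'] by
    about [i * d], so they agree at [u] and [v] within [54 * e] up to a sign, which serves as the
    color. A repetition among the quotients identifies a power of [c] with a power of [a] or its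
    inverse. The separation of [u] and [v] is that of [acyl_pigeonhole] for [D = 54 * e]. *)
Lemma overlap_commensurate K L a n g p p' u v q q' s eta Q :
  acyl X K L -> 0 <= L -> (0 < n)%N -> (Q <= n)%N ->
  acyl_bound K (54 * e) < Q%:R ->
  [/\ isMin (a ^+ n)%g p, isMin (a ^+ n)%g p', isMin (a ^+ n)%g u,
      isMin (a ^+ n)%g q & isMin (a ^+ n)%g q'] ->
  dist p ((a ^+ n)%g • p) = s -> 100 * (e + 1) <= s ->
  0 <= eta -> dist p (g • q) <= eta -> dist p' (g • q') <= eta ->
  [/\ gp p p' u = 0, gp p p' v = 0 & gp u v p = dist p u] ->
  isMin (a ^+ n)%g v ->
  let k := 2 * (Q%:R * (s / n%:R)) + 2 * eta + 100 * e in
  [/\ k < dist p u, k < dist p v, k < dist p' u & k < dist p' v] ->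
  L + 112 * e + 2 <= dist u v ->
  exists k s, (0 < k)%N /\ (g * a ^+ k * g^-1 = signed (a ^+ k) s)%g.
Proof.
move=> acy L0 n0 Qn Qbig [Mp Mp' Mu Mq Mq'] sE big eta0 pq p'q' [pu pv uvp] Mv.
move=> k [kpu kpv kp'u kp'v] far; have e0 := e_ge0 X.
set d := s / n%:R in k kpu kpv kp'u kp'v *.
have d0 : 0 <= d by rewrite divr_ge0 ?ler0n //; lra.
set c := (g * a * g^-1)%g.
have dispM w i : isMin (a ^+ n)%g w -> dist w ((a ^+ i)%g • w) <= i%:R * d + 24 * e.
  move=> Mw; have ws : dist w ((a ^+ n)%g • w) = s by rewrite (isMin_displacement Mp Mw).
  by have := root_displacement_le i n0 Mw; rewrite ws; apply.
have disp_ge w i : (i <= n)%N -> i%:R * d - 6 * e <= dist w ((a ^+ i)%g • w).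
  by move=> lein; have := root_displacement_ge w n0 lein Mp; rewrite sE; apply.
have cE w i : dist (g • w) ((c ^+ i)%g • g • w) = dist w ((a ^+ i)%g • w).
  by rewrite conj_expg !gactM gactK dist_act.
have cE' w i : dist w ((c ^+ i)%g • w) = dist (g^-1%g • w) ((a ^+ i)%g • g^-1%g • w).
  by rewrite -{1 2}(gactVK g w) cE.
set r := 2 * eta + Q%:R * d + 24 * e.
have near w z i : isMin (a ^+ n)%g w -> dist z (g • w) <= eta ->
    dist z ((c ^+ i)%g • z) <= 2 * eta + i%:R * d + 24 * e.
  move=> Mw zw; have := dist_triangle (g • w) z ((c ^+ i)%g • z).
  have := dist_triangle ((c ^+ i)%g • g • w) (g • w) ((c ^+ i)%g • z).
  rewrite dist_act cE (distC (g • w) z); have := dispM w i Mw.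
  by lra.
have iQ i : (i < Q)%N -> i%:R * d <= Q%:R * d.
  by move=> ltiQ; rewrite ler_wpM2r // ler_nat ltnW.
have i0 i : 0 <= i%:R * d by rewrite mulr_ge0 // ler0n.
have r0 : 0 <= r by have := i0 Q; rewrite /r; lra.
have gqu w : gp p p' w = 0 -> k < dist p w -> k < dist p' w -> gp (g • q) (g • q') w <= 2 * e.
  move=> pw dpw dp'w; have -> : 2 * e = 0 + 2 * e by lra.
  have Q0 := i0 Q.
  by apply: (gp_perturb (p := p) (q := p')); rewrite ?pw // (distC w); rewrite /k in dpw dp'w; lra.
have Ta i : (i < Q)%N -> translation p p' u (i%:R * d) r (a ^+ i)%g.
  move=> ltiQ; have := iQ i ltiQ => le; have := dispM p i Mp; have := dispM p' i Mp'.
  have := dispM u i Mu; have := disp_ge u i (leq_trans (ltnW ltiQ) Qn).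
  by rewrite /r; split; lra.
have Tc i : (i < Q)%N -> translation p p' u (i%:R * d) r (c ^+ i)%g.
  move=> ltiQ; have := iQ i ltiQ => le; have := near _ _ i Mq pq; have := near _ _ i Mq' p'q'.
  have := displacement (g • q) (g • q') u (c ^+ i)%g; rewrite !cE.
  have : Num.max (dist q ((a ^+ i)%g • q)) (dist q' ((a ^+ i)%g • q')) <= i%:R * d + 24 * e.
    by rewrite ge_max !dispM.
  have := gqu u pu kpu kp'u; have := disp_ge (g^-1%g • u) i (leq_trans (ltnW ltiQ) Qn).
  rewrite -cE' /r; set m := Num.max _ _ => *.
  by split; lra.
have D i : (i < Q)%N -> deep p p' u v (i%:R * d) r.
  by move=> /iQ le; rewrite /k in kpu kpv kp'u kp'v; rewrite /r; do 2?[split=> //]; lra.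
pose good i s := dist ((a ^+ i)%g • u) (signed (c ^+ i)%g s • u) <= 54 * e /\
                 dist ((a ^+ i)%g • v) (signed (c ^+ i)%g s • v) <= 54 * e.
pose col i := `[< good i true >].
pose f i := ((signed (c ^+ i) (col i))^-1 * a ^+ i)%g.
have gd i : (i < Q)%N -> good i (col i).
  move=> ltiQ; rewrite /col; case: asboolP => // ng.
  by have [[] //] := translations_agree (D i ltiQ) r0 (i0 i) (Ta i ltiQ) (Tc i ltiQ).
have [|||i [j [ij cij fij]]] := acyl_pigeonhole (D := 54 * e) (u := u) (v := v) (f := f)
  col acy L0 _ _ _ Qbig.
- by lra.
- by lra.
- by move=> i /gd[gu gv]; rewrite /f !gactM -!dist_actl !(distC (signed _ _ • _)).
rewrite /f -cij in fij; exists (j - i)%N.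
rewrite subn_gt0 ij -conj_expg -/c; case: (col i) fij => /= fij.
  by exists true; split=> //=; apply: expg_ratioE (ltnW ij) fij.
exists false; split=> //=; rewrite !invgK in fij.
by apply: expg_prodE (ltnW ij) fij.
Qed.

End Overlap.

(** * Projections of translated axes *)

Section Segments.
Variables (R : realType) (G : groupType) (e : R) (X : hyp_action G e).

Local Notation pt := (pt X).
Local Notation "g • x" := (gact g x) (at level 30, right associativity).

Implicit Types (x y z u v w p q : pt) (g h : G).

Lemma signedV g s k : ((signed g s ^+ k)^-1 = signed g (~~ s) ^+ k)%g.
Proof. by case: s; rewrite /signed /= -expVgn // invgK. Qed.

Lemma isMin_signed g y s : isMin g y -> isMin (signed g s) y.
Proof. by case: s => // /isMinV. Qed.

Lemma signed_dist g y s : dist y (signed g s • y) = dist y (g • y).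
Proof. by case: s => //=; rewrite -dist_actl distC. Qed.

Lemma orbit_dist_any g y u k : isMin g y -> 100 * (e + 1) <= dist y (g • y) ->
  k%:R * (dist y (g • y) - 6 * e) <= dist u ((g ^+ k)%g • u).
Proof.
move=> My big; have := @root_dist_ge _ _ _ _ g 1 y u k.
by rewrite expg1 mul1r; apply.
Qed.

Lemma orbit_dist_pos g y u k : (0 < k)%N ->
  isMin g y -> 100 * (e + 1) <= dist y (g • y) ->
  dist y (g • y) - 6 * e <= dist u ((g ^+ k)%g • u).
Proof.
move=> k0 My big; apply: le_trans (orbit_dist_any u k My big).
by have e0 := e_ge0 X; rewrite ler_peMl ?(ler_nat _ 1) //; lra.
Qed.

Definition min_segment g x (N : nat) (z : nat -> pt) :=
  [/\ z 0%N = x, z N = g • x, N%:R = dist x (g • x),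
      forall i j, (i <= j)%N -> (j <= N)%N -> dist (z i) (z j) = j%:R - i%:R &
      forall i, (i <= N)%N -> isMin g (z i)].

(** By the triangle inequality through [g x], a point between [x] and [g x] is moved no more than
    [x], so the whole segment is minimal. *)
Lemma ex_min_segment g x : isMin g x -> exists N (z : nat -> pt), min_segment g x N z.
Proof.
move=> Mx; have [z [z0 zN zd]] := dn_geodesic x (g • x).
set N := dn _ _ in zN zd; exists N, z.
have zdR i j : (i <= j)%N -> (j <= N)%N -> dist (z i) (z j) = j%:R - i%:R.
  by move=> ij jN; rewrite /dist zd ?ij // natrB.
split=> // i iN w; apply: le_trans (Mx w).
have := dist_triangle (g • x) (z i) (g • z i); rewrite dist_act.
have := zdR i N iN (leqnn _); have := zdR 0 i (leq0n _) iN; rewrite z0 zN.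
have : dist x (g • x) = N%:R by [].
by lra.
Qed.

Lemma nearest_gp g x y : isMin g x -> 100 * (e + 1) <= dist x (g • x) ->
  (forall z, isMin g z -> dist y x <= dist y z) -> gp y (g • x) x <= 2 * e + 1 / 2.
Proof.
move=> Mx big near; have e0 := e_ge0 X.
have [N [z [z0 zN NE zd zM]]] := ex_min_segment Mx.
have ee0 : 0 <= 2 * e by lra.
(* Since [k > 2 * e], the alternative [k <= k / 2 + e] of [gp4] at [z k] is impossible; rounding [k]
   up to an integer costs the [1 / 2]. *)
have [k kgt kle] := ex_nat_above ee0.
have kN : (k <= N)%N by rewrite -(ler_nat R) NE; lra.
have := near _ (zM _ kN); have := gp4 (g • x) y (z k) x.
have d1 : dist x (z k) = k%:R by rewrite -{1}z0 zd // subr0.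
have d2 : dist (z k) (g • x) = N%:R - k%:R by rewrite -zN zd.
rewrite /gp d1 (distC (g • x)) d2 -NE (distC x y).
by move=> [] ? ?; lra.
Qed.

Lemma nearest_orbit_gp g x y s k : isMin g x -> 100 * (e + 1) <= dist x (g • x) ->
  (forall z, isMin g z -> dist y x <= dist y z) ->
  gp y ((signed g s ^+ k)%g • x) x <= 3 * e + 1 / 2.
Proof.
move=> Mx big near; have e0 := e_ge0 X.
have bigs : 100 * (e + 1) <= dist x (signed g s • x) by rewrite signed_dist.
have Ms := isMin_signed s Mx.
case: k => [|k]; first by rewrite expg0 gact1 gpxw; lra.
have -> : 3 * e + 1 / 2 = (2 * e + 1 / 2) + e by lra.
apply: (chain_step (c' := 3 * e) (q := signed g s • x)); last by lra.
  apply: nearest_gp => // z Mz; apply: near.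
  by case: s Mz {bigs Ms} => //= /isMinV; rewrite invgK.
by rewrite expgS gactM gp_base gactK; exact: orbit_gp1.
Qed.

(** The shortest segment from [x] to [y] makes small products with both axes. The translated axis is
    reached from [x] only through [y], a long move along the axis of [be], and the translated
    bridge; [chain_step] controls each turn. *)
Lemma far_axes al be x y : isMin al x -> isMin be y ->
  100 * (e + 1) <= dist x (al • x) -> 100 * (e + 1) <= dist y (be • y) ->
  (forall x' y', isMin al x' -> isMin be y' -> dist x y <= dist x' y') ->
  8 * e + 2 <= dist x y ->
  forall s s' t k k' l, (0 < l)%N ->
  gp ((signed al s ^+ k)%g • x)
     ((signed be t ^+ l)%g • (signed al s' ^+ k')%g • x) x <= 5 * e + 1 / 2.
Proof.
move=> Mx My bigx bigy near far; have e0 := e_ge0 X.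
have px s k : gp y ((signed al s ^+ k)%g • x) x <= 3 * e + 1 / 2.
  by apply: nearest_orbit_gp => // z Mz; rewrite !(distC y); apply: near.
have py t l : gp x ((signed be t ^+ l)%g • y) y <= 3 * e + 1 / 2.
  by apply: nearest_orbit_gp => // z Mz; apply: near.
have dh t l w : (0 < l)%N -> 94 * e + 100 <= dist w ((signed be t ^+ l)%g • w).
  move=> l0; have := orbit_dist_pos w l0 (isMin_signed t My).
  by rewrite signed_dist => /(_ bigy); lra.
have step s k t l : (0 < l)%N ->
    gp ((signed al s ^+ k)%g • x) ((signed be t ^+ l)%g • x) x <= 4 * e + 1 / 2.
  move=> l0; set h := (signed be t ^+ l)%g.
  have pyV : gp y (h • x) (h • y) <= 3 * e + 1 / 2.
    by rewrite gp_base gactK /h signedV gpC.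
  have pyh : gp x (h • x) y <= 4 * e + 1 / 2.
    have -> : 4 * e + 1 / 2 = 3 * e + 1 / 2 + e by lra.
    apply: chain_step (py t l) pyV _.
    by have := dh t l y l0; lra.
  have := gp4 (h • x) y ((signed al s ^+ k)%g • x) x; have := px s k.
  have := gp_shift y (h • x) x; rewrite (gpC (h • x) (_ • x)) => ? ? [] ?; lra.
move=> s s' t k k' l l0; set h := (signed be t ^+ l)%g.
have -> : 5 * e + 1 / 2 = 4 * e + 1 / 2 + e by lra.
apply: (chain_step (c' := 4 * e + 1 / 2) (q := h • x)); first exact: step.
  by rewrite gp_base gactK gpC /h signedV; apply: step.
by have := dh t l x l0; rewrite -/h; lra.
Qed.

Lemma segment_gp g x N (z : nat -> pt) i k : isMin g x -> 100 * (e + 1) <= dist x (g • x) ->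
  min_segment g x N z -> (0 < k)%N -> i%:R <= dist x (g • x) / 2 ->
  i%:R - e <= gp (z i) ((g ^+ k)%g • x) x.
Proof.
move=> Mx big [z0 zN NE zd _] k0 il; have e0 := e_ge0 X.
have iN : (i <= N)%N by rewrite -(ler_nat R) NE; lra.
have d1 : dist x (z i) = i%:R by rewrite -{1}z0 zd // subr0.
have d2 : dist (z i) (g • x) = N%:R - i%:R by rewrite -zN zd.
have gx : dist x (g • x) - 3 * e <= gp (g • x) ((g ^+ k)%g • x) x.
  case: k k0 => // k _; rewrite gp_shift gp_base expgS gactM gactK.
  by have := orbit_gp1 k Mx big; lra.
have := gp4 (g • x) (z i) ((g ^+ k)%g • x) x.
by rewrite {1}/gp d1 d2 -NE => -[]; lra.
Qed.

(** Conjugating twice by [g] cancels the sign. *)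
Lemma commensurate_commute g h s : (g * h * g^-1 = signed h s)%g -> commute h (g * g)%g.
Proof.
move=> E; have gh : (g * h = signed h s * g)%g by rewrite -E mulgVK.
rewrite /commute -mulgA gh; case: s gh {E} => /= gh.
  by rewrite [RHS]mulgA gh -mulgA.
have ghV : (g * h^-1 = h * g)%g.
  by apply: (mulIg h); rewrite mulgVK -mulgA gh mulgA mulgV mul1g.
by rewrite [RHS]mulgA ghV -mulgA.
Qed.

End Segments.

(** * Axes that run together for a fraction of a period *)

Section Meeting.
Variables (R : realType) (G : groupType) (e : R) (X : hyp_action G e).

Local Notation pt := (pt X).
Local Notation "g • x" := (gact g x) (at level 30, right associativity).

Implicit Types (x y z u v w p q : pt) (g h : G).

Lemma min_segment_isMin g x s N (z : nat -> pt) i :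
  min_segment (signed g s) x N z -> (i <= N)%N -> isMin g (z i).
Proof. by case=> _ _ _ _ zM /zM; case: s {zM} => //= /isMinV; rewrite invgK. Qed.

(* In a tripod with legs issuing from [x], [y] and [u], two points on the leg
   of [u] are close as soon as they lie at the same distance from [u]. *)
Lemma tripod_close x y u z w :
  dist x z - 2 * e <= gp z u x -> dist y w - e <= gp w u y ->
  dist y w - dist x z = dist y u - dist x u ->
  gp x u y + e <= dist y w -> dist z w <= 8 * e.
Proof.
move=> xz yw E far; have e0 := e_ge0 X.
have low : gp x u y - e <= gp x w y.
  by have [|] := gp4 u x w y; rewrite 1?(gpC u w); lra.
move: xz yw far low; rewrite /gp (distC y x) => xz yw far low.
have := dist4 z w x u; rewrite (distC z x) (distC w x).
by case=> d4; lra.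
Qed.

Section NearAxes.
Variables (K L eta : R) (a : G) (n Q : nat) (x : pt).
Let S := dist x ((a ^+ n)%g • x).
(** The depth that [overlap_commensurate] asks of its two test points. [Sbig] below makes room,
    within a twentieth of a period, for this margin at both ends and the test distance between. *)
Let kap := 2 * (Q%:R * (S / n%:R)) + 2 * eta + 100 * e.
Hypotheses (acy : acyl X K L) (L0 : 0 <= L) (n0 : (0 < n)%N) (Qn : (Q <= n)%N).
Hypothesis Qbig : acyl_bound K (54 * e) < Q%:R.
Hypotheses (Mx : isMin (a ^+ n)%g x) (big : 100 * (e + 1) <= S) (eta0 : 0 <= eta).
Hypothesis Sbig : 2 * kap + L + 120 * e + 10 <= S / 20.

Definition commensurated g :=
  exists k s, (0 < k)%N /\ (g * a ^+ k * g^-1 = signed (a ^+ k) s)%g.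

Let kap0 : 0 <= kap.
Proof.
have e0 := e_ge0 X; have := eta0; have S0 := dist_ge0 x ((a ^+ n)%g • x).
have : 0 <= Q%:R * (S / n%:R) by rewrite mulr_ge0 ?divr_ge0 ?ler0n.
by rewrite /kap; lra.
Qed.

(** Cutting off [k], just above [kap], at both ends of the stretch from [z i] to [z j] leaves the
    test points of [overlap_commensurate]. *)
Lemma segment_commensurated g s N (z : nat -> pt) i j q q' :
  min_segment (signed (a ^+ n)%g s) x N z -> (j <= N)%N ->
  i%:R + (2 * kap + L + 112 * e + 6) <= j%:R ->
  isMin (a ^+ n)%g q -> isMin (a ^+ n)%g q' ->
  dist (z i) (g • q) <= eta -> dist (z j) (g • q') <= eta -> commensurated g.
Proof.
move=> zseg jN ij Mq Mq' zq zq'; have zM' := min_segment_isMin zseg; have e0 := e_ge0 X.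
have [k kgt kle] := ex_nat_above kap0; have := kap0; have := L0 => L1 kap1.
have [_ _ _ zd _] := zseg.
have kkj : (i + k + k <= j)%N by rewrite -(ler_nat R) !natrD; lra.
have ikj : (i + k <= j - k)%N.
  by rewrite leq_subRL ?(addnC k) //; apply: leq_trans kkj; rewrite leq_addl.
have kj : (k <= j)%N by apply: leq_trans kkj; rewrite leq_addl.
have jkN : (j - k <= N)%N by apply: leq_trans jN; rewrite leq_subr.
have lij : (i <= j)%N by apply: leq_trans kkj; rewrite -addnA leq_addr.
have lijk : (i <= j - k)%N by apply: leq_trans ikj; rewrite leq_addr.
have likj : (i + k <= j)%N by apply: leq_trans kkj; rewrite leq_addr.
have d1 : dist (z i) (z (i + k)%N) = k%:R.
  by rewrite zd ?leq_addr ?natrD //; [lra|exact: leq_trans likj jN].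
have d2 : dist (z i) (z (j - k)%N) = j%:R - i%:R - k%:R by rewrite zd // natrB //; lra.
have d3 : dist (z j) (z (i + k)%N) = j%:R - i%:R - k%:R.
  by rewrite distC zd // natrD; lra.
have d4 : dist (z j) (z (j - k)%N) = k%:R.
  by rewrite distC zd ?leq_subr // natrB //; lra.
have d5 : dist (z (i + k)%N) (z (j - k)%N) = j%:R - i%:R - k%:R - k%:R.
  by rewrite zd // natrB // natrD; lra.
have d6 : dist (z i) (z j) = j%:R - i%:R by rewrite zd.
have Mi : isMin (a ^+ n)%g (z i) by apply: zM'; apply: leq_trans lij jN.
have Mj : isMin (a ^+ n)%g (z j) by apply: zM'.
have Mik : isMin (a ^+ n)%g (z (i + k)%N) by apply: zM'; apply: leq_trans likj jN.
have Mjk : isMin (a ^+ n)%g (z (j - k)%N) by apply: zM'.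
have sE : dist (z i) ((a ^+ n)%g • z i) = S by apply: isMin_displacement.
have M5 : [/\ isMin (a ^+ n)%g (z i), isMin (a ^+ n)%g (z j),
  isMin (a ^+ n)%g (z (i + k)%N), isMin (a ^+ n)%g q & isMin (a ^+ n)%g q'] by split.
apply: (overlap_commensurate acy L0 n0 Qn Qbig M5 sE big eta0 zq zq' _ Mjk).
- by rewrite /gp !(distC _ (z i)) !(distC _ (z j)) (distC (z j) (z i)) d1 d2 d3 d4 d5 d6;
     split; lra.
- by rewrite -/kap d1 d2 d3 d4; split; lra.
- by rewrite d5; lra.
Qed.

(* If the axis of [a ^+ n] follows [x] to [h x], then [b], which commutes with
   [h], moves the followed segment little. *)
Lemma follow_commensurated b h s k : commute b h -> (0 < k)%N ->
  dist x (b • x) + 6 * e <= eta ->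
  S / 20 <= gp ((signed (a ^+ n) s ^+ k)%g • x) (h • x) x -> commensurated b.
Proof.
move=> bh k0 bx far; have e0 := e_ge0 X.
have Ms := isMin_signed s Mx.
have [N [z zseg]] := ex_min_segment Ms; have [z0 zN NE zd zM] := zseg.
have SE : dist x (signed (a ^+ n)%g s • x) = S by rewrite signed_dist.
have bigS := big; have := Sbig; have := kap0; have := L0 => L1 kap1 S1.
have S20 : 0 <= S / 20 by lra.
have [i ile igt] := ex_nat_below S20.
have iN : (i <= N)%N by rewrite -(ler_nat R) NE SE; lra.
have dxz : dist x (z i) = i%:R by rewrite -{1}z0 zd // subr0.
have seg : i%:R - e <= gp (z i) ((signed (a ^+ n) s ^+ k)%g • x) x.
  by apply: (segment_gp (isMin_signed s Mx) _ zseg k0); rewrite SE //; lra.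
have lower : i%:R - 2 * e <= gp (z i) (h • x) x.
  by have := gp4 ((signed (a ^+ n) s ^+ k)%g • x) (z i) (h • x) x => -[] ?; lra.
have gpzi : gp x (h • x) (z i) <= 2 * e.
  by have := gp_shift (z i) (h • x) x; rewrite dxz; lra.
apply: (segment_commensurated (i := 0) (j := i) zseg iN _ Mx (min_segment_isMin zseg iN)).
- by rewrite add0r; lra.
- by rewrite z0; lra.
have := displacement x (h • x) (z i) b; rewrite (commute_act _ bh) dist_act.
by rewrite maxxx; lra.
Qed.

(** Both axes leave the path between [x] and [h x] before [S / 20], yet the product at [x] exceeds
    [S / 10]. In between, each follows the leg towards [U'], so they run together. *)
Lemma meet_commensurated h s s' k k' : 8 * e <= eta ->
  gp ((signed (a ^+ n) s ^+ k)%g • x) (h • x) x < S / 20 ->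
  gp ((signed (a ^+ n) s' ^+ k')%g • x) (h^-1%g • x) x < S / 20 ->
  S / 10 < gp ((signed (a ^+ n) s ^+ k)%g • x)
              (h • (signed (a ^+ n) s' ^+ k')%g • x) x -> commensurated h.
Proof.
move=> eta8 lt1 lt2 far; have e0 := e_ge0 X.
have bigS := big; have := Sbig; have := kap0; have := L0 => L1 kap1 S1.
have k0 : (0 < k)%N.
  by case: k far {lt1} => //; rewrite expg0 gact1 gpC gpxw; lra.
have k'0 : (0 < k')%N.
  by case: k' far {lt2} => //; rewrite expg0 gact1; lra.
have [N [z zseg]] := ex_min_segment (isMin_signed s Mx).
have [N' [z' zseg']] := ex_min_segment (isMin_signed s' Mx).
have [z0 zN NE zd _] := zseg; have [z0' zN' NE' zd' _] := zseg'.
have SE s1 : dist x (signed (a ^+ n)%g s1 • x) = S by rewrite signed_dist.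
rewrite SE in NE; rewrite SE in NE'.
set u := (signed (a ^+ n) s ^+ k)%g • x in lt1 far.
set u' := (signed (a ^+ n) s' ^+ k')%g • x in lt2 far.
set U' := h • u' in far.
have lt2' : gp x U' (h • x) < S / 20 by rewrite gp_base gactK gpC.
have gphx : gp (h • x) U' x <= gp u (h • x) x + e.
  by have [|] := gp4 U' u (h • x) x; rewrite 1?(gpC U'); lra.
have shift := gp_shift (h • x) U' x.
have gpE : 2 * gp (h • x) U' x = dist x (h • x) + dist x U' - dist (h • x) U'.
  by rewrite /gp; lra.
have gp_le := gp_lel (h • x) U' x; have gp_ge := gp_ge0 (h • x) U' x.
have close i : S / 20 + 4 * e < i%:R -> i%:R <= S / 10 ->
    exists2 j : nat, (j <= N')%N & dist (z i) (h • z' j) <= 8 * e.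
  move=> lo hi.
  have iN : (i <= N)%N by rewrite -(ler_nat R) NE; lra.
  have F1 := dist_triangle x (h • x) U'.
  have jE : dist x U' <= i%:R + dist (h • x) U'.
    by lra.
  (* The index for which [z i] and [h (z' j)] are equally far along the leg towards [U'], as
     [tripod_close] requires; [jE] makes the subtraction exact. *)
  set j := (i + dn (h • x) U' - dn x U')%N.
  have jR : j%:R = i%:R + dist (h • x) U' - dist x U'.
    by rewrite /j natrB ?natrD // -(ler_nat R) natrD.
  have jS : j%:R <= S / 2 by rewrite jR; lra.
  have jN : (j <= N')%N by rewrite -(ler_nat R) NE'; lra.
  exists j => //.
  have dxz : dist x (z i) = i%:R by rewrite -{1}z0 zd // subr0.
  have dxz' : dist x (z' j) = j%:R by rewrite -{1}z0' zd' // subr0.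
  have seg : i%:R - e <= gp (z i) u x.
    by apply: (segment_gp (isMin_signed s Mx) _ zseg k0); rewrite SE //; lra.
  have seg' : j%:R - e <= gp (h • z' j) U' (h • x).
    by rewrite gp_act; apply: (segment_gp (isMin_signed s' Mx) _ zseg' k'0); rewrite SE //; lra.
  set w := h • z' j in seg' *.
  have dw : dist (h • x) w = j%:R by rewrite dist_act.
  have ziU : i%:R - 2 * e <= gp (z i) U' x.
    by have [] := gp4 u (z i) U' x; lra.
  apply: (tripod_close (x := x) (y := h • x) (u := U')); rewrite ?dxz ?dw //; lra.
have low0 : 0 <= S / 20 + 4 * e by lra.
have [i igt ile] := ex_nat_above low0.
have high0 : 0 <= S / 10 by lra.
have [j jle jgt] := ex_nat_below high0.
have iS : i%:R <= S / 10 by lra.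
have jS : S / 20 + 4 * e < j%:R by lra.
have [i' i'N zi] := close i igt iS; have [j' j'N zj] := close j jS jle.
have jN : (j <= N)%N by rewrite -(ler_nat R) NE; lra.
have ij : i%:R + (2 * kap + L + 112 * e + 6) <= j%:R by lra.
exact: segment_commensurated zseg jN ij (min_segment_isMin zseg' i'N)
  (min_segment_isMin zseg' j'N) (le_trans zi eta8) (le_trans zj eta8).
Qed.

End NearAxes.
End Meeting.

Section Projection.
Variables (R : realType) (G : groupType) (e : R) (X : hyp_action G e).

Local Notation pt := (pt X).
Local Notation "g • x" := (gact g x) (at level 30, right associativity).

Implicit Types (x y z u v w p q : pt) (g h : G).

Lemma commensurated_root (a b : G) m l t : commensurated a (signed (b ^+ m)%g t ^+ l)%g ->
  (0 < m * l)%N -> exists i j, [/\ (0 < i)%N, (0 < j)%N & commute (a ^+ i)%g (b ^+ j)%g].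
Proof.
move=> [k [s [k0 /commensurate_commute com]]] ml0; rewrite -expg2 -expgnA in com.
exists k, (m * (l * 2))%N; split=> //; first by rewrite mulnA muln_gt0 ml0.
rewrite expgnA; case: t com => //= /commuteV.
by rewrite -expVgn invgK.
Qed.

Lemma projection_bound K L (a b : G) n m Q x0 :
  acyl X K L -> 0 <= L -> (0 < n)%N -> (0 < m)%N -> (Q <= n)%N ->
  acyl_bound K (54 * e) < Q%:R ->
  (forall z, 100 * (e + 1) <= dist z ((a ^+ n)%g • z)) ->
  (forall z, 100 * (e + 1) <= dist z ((b ^+ m)%g • z)) ->
  (forall x y, isMin (a ^+ n)%g x -> isMin (b ^+ m)%g y ->
     dist y ((b ^+ m)%g • y) / m%:R <= dist x ((a ^+ n)%g • x) / n%:R) ->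
  (forall x, isMin (a ^+ n)%g x ->
     let S := dist x ((a ^+ n)%g • x) in
     2 * (2 * (Q%:R * (S / n%:R)) + 2 * (S / n%:R + 60 * e + 10) + 100 * e) +
       L + 120 * e + 10 <= S / 20) ->
  (forall i j, (0 < i)%N -> (0 < j)%N -> ~ commute (a ^+ i)%g (b ^+ j)%g) ->
  exists2 x : pt, isMin (a ^+ n)%g x &
    forall s s' t k k' l, (0 < l)%N ->
    gp ((signed (a ^+ n) s ^+ k)%g • x)
       ((signed (b ^+ m) t ^+ l)%g • (signed (a ^+ n) s' ^+ k')%g • x) x <=
    dist x ((a ^+ n)%g • x) / 10.
Proof.
move=> acy L0 n0 m0 Qn Qbig biga bigb ratio Sbig ncomm; have e0 := e_ge0 X.
have [[x y] [/= Mx My] xymin] := @ex_minimizer (pt * pt)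
  (fun c => isMin (a ^+ n)%g c.1 /\ isMin (b ^+ m)%g c.2) (fun c => dn c.1 c.2)
  (let: ex_intro x Mx := ex_isMin (a ^+ n)%g (inhabits x0) in
   let: ex_intro y My := ex_isMin (b ^+ m)%g (inhabits x0) in
   ex_intro _ (x, y) (conj Mx My)).
exists x => // s s' t k k' l l0.
have bigx := biga x; have bigy := bigb y.
set h := (signed (b ^+ m) t ^+ l)%g; set u' := (_ ^+ k')%g • x; set u := (_ ^+ k)%g • x.
set S := dist x _ in bigx *.
(* If the axes are far apart the shortest segment between them separates; if
   not, [b] moves [x] by about a translation length of [a] at most. *)
have [far|near] := lerP (8 * e + 2) (dist x y).
  have xyR x' y' : isMin (a ^+ n)%g x' -> isMin (b ^+ m)%g y' -> dist x y <= dist x' y'.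
    by move=> Mx' My'; rewrite ler_nat; apply: (xymin (x', y')).
  by have := far_axes Mx My bigx bigy xyR far s s' t k k' l0; rewrite -/h -/u -/u'; lra.
rewrite leNgt; apply/negP => meet.
set eta := S / n%:R + 60 * e + 10.
have Sn0 : 0 <= S / n%:R by rewrite divr_ge0 ?ler0n ?dist_ge0.
have eta0 : 0 <= eta by rewrite /eta; lra.
have comb_h : commute b h.
  rewrite /h; case: t {h meet} => /=; last rewrite expVgn; do ?[apply/commuteV].
    exact/commuteX/commuteX.
  exact/commuteX/commuteX.
have dby : dist y (b • y) <= S / n%:R + 24 * e.
  have := root_displacement_le 1 m0 My bigy; rewrite expg1 mul1r.
  by have := ratio x y Mx My; rewrite -/S; lra.
have dbx : dist x (b • x) + 6 * e <= eta.
  have := dist_triangle y x (b • x); have := dist_triangle (b • y) y (b • x).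
  by rewrite dist_act (distC y x) /eta; lra.
(* Two commensurations must be excluded: that by [b], for an axis following the path between [x] and
   its translate, and that by [h], for two axes meeting beyond it. *)
have nb : ~ commensurated a b.
  move=> cb; have [|//|i [j [i0 j0]]] := @commensurated_root a b 1 1 true; last exact: ncomm.
  by rewrite /= !expg1.
have nh : ~ commensurated a h.
  by move=> /commensurated_root[|i [j [i0 j0]]]; [rewrite muln_gt0 m0|exact: ncomm].
have S1 := Sbig x Mx; rewrite -/S -/eta in S1.
have k0 : (0 < k)%N.
  by case: k @u meet => //=; rewrite expg0 gact1 gpC gpxw; lra.
have k'0 : (0 < k')%N \/ u' = x.
  by case: k' @u' {meet} => /=; [right; rewrite expg0 gact1|left].
apply: nh; apply: (meet_commensurated (s := s) (s' := s') (k := k) (k' := k') acy L0 n0 Qn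
  Qbig Mx bigx eta0 S1).
- by rewrite /eta; lra.
- rewrite ltNge; apply/negP => le; apply: nb.
  exact: (follow_commensurated acy L0 n0 Qn Qbig Mx bigx eta0 S1 comb_h k0 dbx le).
- rewrite ltNge; apply/negP => le; apply: nb.
  case: k'0 => [k'0|xu'].
    apply: (follow_commensurated acy L0 n0 Qn Qbig Mx bigx eta0 S1 _ k'0 dbx le).
    exact/commuteV.
  by move: le; rewrite -/u' xu' gpC gpxw -/S; lra.
- exact: meet.
Qed.

End Projection.

(** * Reduced words and their syllables *)

Section Words.
Variables (G : groupType) (I : eqType) (f : I -> G).
Implicit Types (u v : I * bool) (w : seq (I * bool)).

Lemma word_eval_nil : word_eval f [::] = 1%g.
Proof. by rewrite /word_eval big_nil. Qed.

Lemma word_eval_cat w1 w2 : word_eval f (w1 ++ w2) = (word_eval f w1 * word_eval f w2)%g.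
Proof. by rewrite /word_eval big_cat. Qed.

Lemma word_eval_cons u w : word_eval f (u :: w) = (signed (f u.1) u.2 * word_eval f w)%g.
Proof. by rewrite /word_eval big_cons. Qed.

Lemma word_eval_nseq k u : word_eval f (nseq k u) = (signed (f u.1) u.2 ^+ k)%g.
Proof.
elim: k => [|k IH]; first by rewrite word_eval_nil.
by rewrite word_eval_cons IH expgS.
Qed.

Definition avoids_head (i : I) w := if w is v :: _ then v.1 != i else true.

Lemma reduced_syllable u w : reduced (u :: w) -> exists k w',
  [/\ u :: w = nseq k.+1 u ++ w', reduced w' & avoids_head u.1 w'].
Proof.
elim: w u => [|v w IH] u; first by exists 0%N, [::].
move=> /[dup] red; rewrite /reduced /= => /andP[vu redv].
have [vu1|nvu1] := eqVneq v.1 u.1; last by exists 0%N, (v :: w).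
have E : v = u.
  apply/pair_eqP; rewrite /pair_eq vu1 eqxx /=.
  by move: vu; rewrite -pair_eqE /pair_eq /= vu1 eqxx /=; case: (v.2); case: (u.2).
have [k [w' [eqw red' hd]]] := IH v redv.
by exists k.+1, w'; split=> //; [rewrite eqw E|rewrite -E].
Qed.

End Words.

(** * Growth along reduced words *)

Section Growth.
Variables (R : realType) (G : groupType) (e : R) (X : hyp_action G e).

Local Notation pt := (pt X).
Local Notation "g • x" := (gact g x) (at level 30, right associativity).

Implicit Types (x y z u v w p q : pt) (g h : G).

(* In a word, the powers of [f ia] make definite progress, and the powers of
   [f ib] in between cannot cancel more than a tenth of it on either side. *)
Lemma orbit_growth (I : eqType) (f : I -> G) (ia ib : I) x y :
  (forall i, i = ia \/ i = ib) ->
  isMin (f ia) x -> isMin (f ib) y ->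
  100 * (e + 1) <= dist x (f ia • x) -> 100 * (e + 1) <= dist y (f ib • y) ->
  (forall s s' t k k' l, (0 < l)%N ->
    gp ((signed (f ia) s ^+ k)%g • x)
       ((signed (f ib) t ^+ l)%g • (signed (f ia) s' ^+ k')%g • x) x <=
    dist x (f ia • x) / 10) ->
  forall w : seq (I * bool), reduced w -> (size w)%:R <= dist x (word_eval f w • x).
Proof.
move=> Iab Mx My bigx bigy proj; have e0 := e_ge0 X.
set S := dist x _ in bigx proj *; set B := S / 10.
have a_dist s k : k%:R * (S - 6 * e) <= dist x ((signed (f ia) s ^+ k)%g • x).
  have := orbit_dist k (isMin_signed s Mx); rewrite signed_dist; exact.
have b_dist t l : l%:R * (94 * e + 100) <= dist x ((signed (f ib) t ^+ l)%g • x).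
  have := orbit_dist_any x l (isMin_signed t My); rewrite signed_dist => /(_ bigy).
  by apply: le_trans; rewrite ler_wpM2l ?ler0n //; lra.
have other i : i != ia -> i = ib by case: (Iab i) => ->; rewrite ?eqxx.
(* The words treated here are empty or begin with a syllable in [ib]. The first clause is what
   allows a power of [f ia] to be put in front of them. *)
have main N : forall w : seq (I * bool), (size w < N)%N -> reduced w ->
    avoids_head ia w ->
    (forall s k, gp ((signed (f ia) s ^+ k)%g • x) (word_eval f w • x) x <= B + e) /\
    (size w)%:R <= dist x (word_eval f w • x).
  elim: N => // N IH [|[i t] w]; first by
    rewrite word_eval_nil gact1 distxx => *; split=> // *; rewrite gpxw /B; lra.
  move=> szw redw /= /other ?; subst i.
  have [l [w' [eqw redw' hd]]] := reduced_syllable redw.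
  have sz : (size w).+1 = (l.+1 + size w')%N.
    by have := congr1 size eqw; rewrite size_cat size_nseq.
  rewrite sz eqw word_eval_cat word_eval_nseq /=; rewrite /= sz in szw.
  set h := (signed (f ib) t ^+ l.+1)%g.
  have dh := b_dist t l.+1; rewrite -/h in dh.
  have l1 : l.+1%:R * 1 <= l.+1%:R * (94 * e + 100) by rewrite ler_wpM2l ?ler0n //; lra.
  case: w' => [|[i s'] w'] in eqw redw' hd sz szw *.
    rewrite word_eval_nil mulg1 /= addn0; split; last by lra.
    move=> s k; have := proj s true t k 0%N l.+1 isT.
    by rewrite expg0 gact1 -/h -/B; lra.
  have ? : i = ia by move: hd => /=; case: (Iab i) => ->; rewrite ?eqxx.
  subst i; have [k' [w2 [eqw' redw2 hd2]]] := reduced_syllable redw'.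
  have sz' : (size w').+1 = (k'.+1 + size w2)%N.
    by have := congr1 size eqw'; rewrite size_cat size_nseq.
  rewrite /= sz' in szw; rewrite [size (_ :: _)]sz' eqw' word_eval_cat word_eval_nseq /=.
  set p := (signed (f ia) s' ^+ k'.+1)%g.
  have sz2 : (size w2 < N)%N.
    by clear -szw; lia.
  have [IH1 IH2] := IH w2 sz2 redw2 hd2.
  rewrite !gactM; set z := word_eval f w2 • x in IH1 IH2 *.
  have dp := a_dist s' k'.+1; rewrite -/p in dp.
  (* The syllable [p] loses at most [2 * B] at its beginning ([g1]) and [2 * (B + 2 * e)] at its end
     ([g2]); since [B = S / 10] and [S >= 100 * (e + 1)], enough remains to pay one per letter. *)
  have k1 : k'.+1%:R * 1 <= k'.+1%:R * (S - 6 * e) - 4 * B - 4 * e.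
    have : 0 <= k'%:R * (S - 6 * e - 1) by rewrite mulr_ge0 ?ler0n //; lra.
    by rewrite -[k'.+1%:R]natr1 /B; lra.
  have d1 : dist x (h • p • x) =
      dist x (h • x) + dist x (p • x) - 2 * gp (p • x) (h^-1%g • x) x.
    have -> : dist x (h • p • x) = dist (p • x) (h^-1%g • x) by rewrite dist_actr distC.
    have -> : dist x (h • x) = dist x (h^-1%g • x) by rewrite -dist_actl distC.
    by rewrite /gp; lra.
  have g1 : gp (p • x) (h^-1%g • x) x <= B.
    by have := proj s' true (~~ t) k'.+1 0%N l.+1 isT; rewrite expg0 gact1 -signedV.
  have dpV : dist x (p^-1%g • x) = dist x (p • x) by rewrite -dist_actl distC.
  have big' : S - 6 * e <= dist x (p • x).
    by apply: le_trans dp; rewrite ler_peMl ?(ler_nat _ 1) //; lra.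
  have g2 : gp x (h • p • z) (h • p • x) <= B + 2 * e.
    rewrite -(gp_act h^-1%g) -(gp_act p^-1%g) !gactK gpC.
    have -> : B + 2 * e = B + e + e by lra.
    apply: (chain_step (c' := B) (q := p^-1%g • x)).
    - by rewrite gpC signedV; apply: IH1.
    - by rewrite gp_base invgK gactVK.
    - by rewrite dpV /B; lra.
  have d2 : dist x (h • p • z) =
      dist x (h • p • x) + dist x z - 2 * gp x (h • p • z) (h • p • x).
    by rewrite /gp (distC (h • p • x) x) !dist_act; lra.
  split; last by rewrite natrD natrD; lra.
  move=> s k; have g4 := gp_shift (h • p • x) (h • p • z) x.
  have d3 := dist_ge0 x (h • x); have p1 := proj s s' t k k'.+1 l.+1 isT.
  rewrite -/h -/p -/B in p1.
  have [|] := gp4 (h • p • z) ((signed (f ia) s ^+ k)%g • x) (h • p • x) x.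
    by lra.
  rewrite (gpC (h • p • z)) => g5.
  by exfalso; rewrite /B in g2 g5 p1 d1 g1 *; lra.
move=> w redw; have [hd|hd] := boolP (avoids_head ia w).
  by have [] := main (size w).+1 w (ltnSn _) redw hd.
case: w => [|[i s] w] //= in redw hd *.
move/negPn/eqP: hd => ?; subst i.
have [k [w' [eqw redw' hd']]] := reduced_syllable redw.
have -> : (size w).+1 = (k.+1 + size w')%N.
  by have := congr1 size eqw; rewrite size_cat size_nseq.
have [G1 G2] := main (size w').+1 w' (ltnSn _) redw' hd'.
rewrite eqw word_eval_cat word_eval_nseq gactM /=.
have dk := a_dist s k.+1; have := G1 (~~ s) k.+1; rewrite -signedV.
move: dk; set p := (signed (f ia) s ^+ k.+1)%g => dk.
have dpV : dist x (p^-1%g • x) = dist x (p • x) by rewrite -dist_actl distC.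
rewrite /gp [dist (p^-1%g • x) _]dist_actl invgK dpV natrD => G1'.
have : k.+1%:R * 1 <= k.+1%:R * (S - 6 * e) - 2 * B - 2 * e.
  have : 0 <= k%:R * (S - 6 * e - 1) by rewrite mulr_ge0 ?ler0n //; lra.
  by rewrite -[k.+1%:R]natr1 /B; lra.
by lra.
Qed.

End Growth.

(** * Geometric realizations of graphs *)

Section SlimFourPoint.
Variables (R : realType) (X : Type) (d : X -> X -> R) (delta : R).
Hypotheses (d_sym : forall x y, d x y = d y x)
  (d_tri : forall y x z, d x z <= d x y + d y z) (hyp : hyperbolic_space d delta).
Implicit Types x y z w p q : X.

Let gpr x y w : R := (d w x + d w y - d x y) / 2.

Lemma d_ge0 x y : d x x = 0 -> 0 <= d x y.
Proof. by move=> dxx; have := d_tri y x x; rewrite dxx (d_sym y x); lra. Qed.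

Lemma segment_split p q A z : d p p = 0 -> geodesic_segment d p q A -> A z ->
  d p z + d z q = d p q.
Proof.
move=> dpp [c [c0 cd iso ->]] [t /= /andP[t0 td] <-].
have pq0 := d_ge0 q dpp.
have := iso 0 t; have := iso t (d p q).
rewrite c0 cd !lexx pq0 t0 td => /(_ isT isT) -> /(_ isT isT) ->.
by rewrite sub0r normrN ger0_norm // ler0_norm; lra.
Qed.

Lemma segment_point p q A t : geodesic_segment d p q A -> 0 <= t <= d p q ->
  exists2 z, A z & d p z = t.
Proof.
move=> [c [c0 cd iso ->]] /andP[t0 td].
exists (c t); first by exists t => //=; rewrite t0.
have := iso 0 t; rewrite c0 lexx t0 td (le_trans t0 td) => /(_ isT isT) ->.
by rewrite sub0r normrN ger0_norm.
Qed.

(** The point [p] of the side from [x] to [y] is where the tripod of [x], [y], [w] branches, and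
    slimness places it within [gpr x y w + 2 * delta] of [w]. In the triangle on [x], [y], [v] it is
    close to one of the two other sides, and which one decides the alternative. *)
Lemma slim_four_point : (forall x, d x x = 0) -> forall x y u v,
  d x y + d u v <= d x u + d y v + 2 * (3 * delta) \/
  d x y + d u v <= d x v + d y u + 2 * (3 * delta).
Proof.
move=> dxx x y w v; have [geo slim] := hyp.
have [A gA] := geo x y; have [B gB] := geo y w; have [C gC] := geo w x.
have [wx wy vw] : [/\ d w x = d x w, d w y = d y w & d w v = d v w] by split.
have [yx vx vy] : [/\ d y x = d x y, d v x = d x v & d v y = d y v] by split.
have [|p Ap xp] := segment_point (t := gpr w y x) gA.
  rewrite /gpr; have := d_tri w x y; have := d_tri y x w; have := d_tri x y w.
  by move=> *; apply/andP; split; lra.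
have xpy := segment_split (dxx x) gA Ap.
have [px py pw] : [/\ d p x = d x p, d p y = d y p & d p w = d w p] by split.
rewrite /gpr in xp.
have wp : d w p <= gpr x y w + 2 * delta.
  rewrite /gpr; have [+ _ _] := slim _ _ _ _ _ _ gA gB gC.
  move=> /(_ _ Ap)[q [Bq|Cq] pq].
    have [qy qw qp] : [/\ d q y = d y q, d q w = d w q & d q p = d p q] by split.
    have := segment_split (dxx y) gB Bq; have := d_tri q y p; have := d_tri q w p.
    by lra.
  have [qx qw qp] : [/\ d q x = d x q, d q w = d w q & d q p = d p q] by split.
  have := segment_split (dxx w) gC Cq; have := d_tri q x p; have := d_tri q w p.
  by lra.
rewrite /gpr in wp.
have [B' gB'] := geo y v; have [C' gC'] := geo v x.
have [+ _ _] := slim _ _ _ _ _ _ gA gB' gC'.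
move=> /(_ _ Ap)[q [Bq|Cq] pq].
  have [qy qw qv] : [/\ d q y = d y q, d q w = d w q & d q v = d v q] by split.
  have := segment_split (dxx y) gB' Bq; have := d_tri p w q.
  have := d_tri q w y; have := d_tri q w v.
  by left; lra.
have [qx qw qv] : [/\ d q x = d x q, d q w = d w q & d q v = d v q] by split.
have := segment_split (dxx v) gC' Cq; have := d_tri p w q.
have := d_tri q w x; have := d_tri q w v.
by right; lra.
Qed.

End SlimFourPoint.

Section Realization.
Variables (R : realType) (Gam : graph).
Implicit Types (p q r : gpoint R Gam) (u v w : vertex Gam) (l s t : R).

Lemma edge_point0 (ed : edge Gam) : edge_point ed (0 : R) = Vtx R (end0 ed).
Proof. by rewrite /edge_point insubF ?ltxx // lexx. Qed.

Lemma edge_point1 (ed : edge Gam) : edge_point ed (1 : R) = Vtx R (end1 ed).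
Proof. by rewrite /edge_point insubF ?ltxx ?andbF // leNgt ltr01. Qed.

Lemma edge_point_inner (ed : edge Gam) (t : {t : R | 0 < t < 1}) :
  edge_point ed (val t) = Inner ed t.
Proof. by rewrite /edge_point valK. Qed.

Lemma edge_pointP (ed : edge Gam) t (P : gpoint R Gam -> R -> Prop) : 0 <= t <= 1 ->
  P (Vtx R (end0 ed)) 0 -> P (Vtx R (end1 ed)) 1 ->
  (forall u : {t : R | 0 < t < 1}, P (Inner ed u) (val u)) -> P (edge_point ed t) t.
Proof.
move=> /andP[t0 t1] P0 P1 Pu.
have [->|t0'] := eqVneq t 0; first by rewrite edge_point0.
have [->|t1'] := eqVneq t 1; first by rewrite edge_point1.
have tin : 0 < t < 1 by rewrite !lt_neqAle t0 t1 eq_sym t0' t1'.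
by have := Pu (Sub t tin); rewrite -edge_point_inner.
Qed.

Lemma pl_path_ge0 p q l : pl_path p q l -> 0 <= l.
Proof. by elim=> // *; rewrite addr_ge0. Qed.

Lemma pl_path_cat q p r l l' : pl_path p q l -> pl_path q r l' -> pl_path p r (l + l').
Proof.
elim=> [x|ed s t y k s01 t01 _ IH] qr; first by rewrite add0r.
by rewrite -addrA; apply: pl_cons => //; apply: IH.
Qed.

Lemma pl_path_rev p q l : pl_path p q l -> pl_path q p l.
Proof.
elim=> [x|ed s t y k s01 t01 _ IH]; first exact: pl_nil.
rewrite addrC distrC -[`|_|]addr0; apply: pl_path_cat IH _.
exact/pl_cons/pl_nil.
Qed.

Inductive epath : vertex Gam -> vertex Gam -> nat -> Prop :=
| epath_nil u : epath u u 0
| epath_fwd ed v k : epath (end1 ed) v k -> epath (end0 ed) v k.+1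
| epath_bwd ed v k : epath (end0 ed) v k -> epath (end1 ed) v k.+1.

Lemma epath_pl u v k : epath u v k -> pl_path (Vtx R u) (Vtx R v) k%:R.
Proof.
elim=> {u v k} [u|ed v k _ IH|ed v k _ IH]; first exact: pl_nil.
  have -> : k.+1%:R = `|0 - 1| + k%:R :> R by rewrite sub0r normrN normr1 nat1r.
  by rewrite -edge_point0; apply: pl_cons; rewrite ?lexx ?ler01 // edge_point1.
have -> : k.+1%:R = `|1 - 0| + k%:R :> R by rewrite subr0 normr1 nat1r.
by rewrite -edge_point1; apply: pl_cons; rewrite ?lexx ?ler01 // edge_point0.
Qed.

(* For [p] inside an edge, an edge path starts at one of its ends. *)
Definition reach v p l : Prop :=
  match p with
  | Vtx u => exists2 k, epath u v k & k%:R <= l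
  | Inner ed t => exists k, epath (end0 ed) v k /\ k%:R + val t <= l \/
                            epath (end1 ed) v k /\ k%:R + (1 - val t) <= l
  end.

Lemma reach_edge_point v ed t l : 0 <= t <= 1 ->
  reach v (edge_point ed t) l <->
  exists k, epath (end0 ed) v k /\ k%:R + t <= l \/ epath (end1 ed) v k /\ k%:R + (1 - t) <= l.
Proof.
move=> t01; apply: (edge_pointP (P := fun p t => reach v p l <-> exists k,
  epath (end0 ed) v k /\ k%:R + t <= l \/
  epath (end1 ed) v k /\ k%:R + (1 - t) <= l)) => //=.
- split=> [[k kp kl]|[k [[kp kl]|[kp kl]]]].
  + by exists k; left; rewrite addr0.
  + by exists k => //; rewrite addr0 in kl.
  + by exists k.+1; [exact: epath_fwd|rewrite -natr1; lra].
- split=> [[k kp kl]|[k [[kp kl]|[kp kl]]]].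
  + by exists k; right; split=> //; lra.
  + by exists k.+1; [exact: epath_bwd|rewrite -natr1; lra].
  + by exists k => //; lra.
Qed.

(** Moving inside an edge changes the distances to its ends by at most the length travelled, so a
    path ending at a vertex is no shorter than some edge path. This makes vertex distances
    integers. *)
Lemma pl_path_reach p v l : pl_path p (Vtx R v) l -> reach v p l.
Proof.
move E : (Vtx R v) => q pq.
elim: pq E => [{}p <-|ed s t r k s01 t01 _ IH E] /=; first by exists 0%N => //; exact: epath_nil.
have /(reach_edge_point _ _ _ t01)[j jp] := IH E.
apply/(reach_edge_point _ _ _ s01); exists j.
have := ler_norm (s - t); have := ler_norm (t - s); rewrite (distrC t s) => n1 n2.
by case: jp => -[jp le]; [left|right]; split=> //; lra.
Qed.

Hypothesis geo : geodesic_space (@gdist R Gam).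

Let plset p q : set R := [set l | pl_path p q l].

Lemma plset_lbound p q : has_lbound (plset p q).
Proof. by exists 0 => l /pl_path_ge0. Qed.

(** Without a path, [gdist p q] is [inf set0 = 0]; a geodesic of length zero then forces [p = q],
    which the trivial path joins. *)
Lemma plset_nonempty p q : plset p q !=set0.
Proof.
apply: contrapT => /set0P/negP/negPn/eqP E.
have d0 : gdist p q = 0 by rewrite /gdist -/(plset p q) E inf0.
have [A [c [c0 cd _ _]]] := geo p q.
have pq : p = q by rewrite -c0 -cd d0.
by have : plset p q 0; [rewrite /plset /= pq; exact: pl_nil|rewrite E].
Qed.

Lemma gdist_le p q l : pl_path p q l -> gdist p q <= l.
Proof. by move=> pq; apply: ge_inf => //; exact: plset_lbound. Qed.

Lemma gdist_ge0 p q : 0 <= gdist p q.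
Proof. by apply: lb_le_inf; [exact: plset_nonempty|move=> l /pl_path_ge0]. Qed.

Lemma gdistxx p : gdist p p = 0.
Proof. by apply/eqP; rewrite eq_le gdist_ge0 andbT; apply/gdist_le/pl_nil. Qed.

Lemma gdistC p q : gdist p q = gdist q p.
Proof. by rewrite /gdist; congr inf; apply/seteqP; split=> l /pl_path_rev. Qed.

Lemma gdist_triangle q p r : gdist p r <= gdist p q + gdist q r.
Proof.
apply/ler_addgt0Pr => eps eps0.
have e2 : 0 < eps / 2 by lra.
have hi p' q' : has_inf (plset p' q').
  by split; [exact: plset_nonempty|exact: plset_lbound].
have [l1 pl1 lt1] := inf_adherent e2 (hi p q).
have [l2 pl2 lt2] := inf_adherent e2 (hi q r).
apply: le_trans (gdist_le (pl_path_cat pl1 pl2)) _.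
by rewrite /gdist -/(plset p q) -/(plset q r); lra.
Qed.

Lemma vertex_distance u v : exists2 k, epath u v k & gdist (Vtx R u) (Vtx R v) = k%:R.
Proof.
have [|k kp kmin] := @ex_minimizer nat (fun k => epath u v k) id.
  by have [l /pl_path_reach [k kp _]] := plset_nonempty (Vtx R u) (Vtx R v); exists k.
exists k => //; apply/eqP; rewrite eq_le gdist_le; last exact: epath_pl.
apply: lb_le_inf; first exact: plset_nonempty.
move=> l /pl_path_reach [j jp jl]; apply: le_trans jl.
by rewrite ler_nat; apply: kmin.
Qed.

Definition vdist u v : nat := Num.truncn (gdist (Vtx R u) (Vtx R v)).

Lemma vdistE u v : gdist (Vtx R u) (Vtx R v) = (vdist u v)%:R.
Proof. by rewrite /vdist; have [k _ ->] := vertex_distance u v; rewrite natrK. Qed.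

Lemma vdist_epath u v : epath u v (vdist u v).
Proof.
have [k kp kE] := vertex_distance u v.
by move: kE; rewrite vdistE => /eqP; rewrite eqr_nat => /eqP ->.
Qed.

Lemma vdist_le u v k : epath u v k -> (vdist u v <= k)%N.
Proof. by move=> /epath_pl /gdist_le; rewrite vdistE ler_nat. Qed.

Lemma vdist_triangle v u w : (vdist u w <= vdist u v + vdist v w)%N.
Proof. by rewrite -(ler_nat R) natrD -!vdistE gdist_triangle. Qed.

Lemma epath_vertices u v k : epath u v k -> exists z : nat -> vertex Gam,
  [/\ z 0%N = u, z k = v & forall i j, (i <= j <= k)%N -> (vdist (z i) (z j) <= j - i)%N].
Proof.
elim=> {u v k} [u|ed v k _ [z [z0 zk zd]]|ed v k _ [z [z0 zk zd]]].
- exists (fun=> u); split=> // i j _.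
  by rewrite (leq_trans (vdist_le (epath_nil u))).
- exists (fun i => if i is i'.+1 then z i' else end0 ed); split=> // -[|i] [|j] ij.
  + exact: vdist_le (epath_nil _).
  + apply: leq_trans (vdist_triangle (z 0%N) _ _) _; rewrite subn0 -add1n leq_add //.
      by rewrite z0; apply/vdist_le/epath_fwd/epath_nil.
    by rewrite -[X in (_ <= X)%N](subn0 j) zd.
  + by rewrite ltn0 in ij.
  + by rewrite subSS zd.
- exists (fun i => if i is i'.+1 then z i' else end1 ed); split=> // -[|i] [|j] ij.
  + exact: vdist_le (epath_nil _).
  + apply: leq_trans (vdist_triangle (z 0%N) _ _) _; rewrite subn0 -add1n leq_add //.
      by rewrite z0; apply/vdist_le/epath_bwd/epath_nil.
    by rewrite -[X in (_ <= X)%N](subn0 j) zd.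
  + by rewrite ltn0 in ij.
  + by rewrite subSS zd.
Qed.

Lemma vdist_geodesic u v : exists z : nat -> vertex Gam,
  [/\ z 0%N = u, z (vdist u v) = v &
    forall i j, (i <= j <= vdist u v)%N -> vdist (z i) (z j) = (j - i)%N].
Proof.
have [z [z0 zk zd]] := epath_vertices (vdist_epath u v).
exists z; split=> // i j /[dup] /andP[ij jk] ijk; apply/eqP; rewrite eqn_leq zd //=.
have := vdist_triangle (z i) u v; have := vdist_triangle (z j) (z i) v.
have := zd 0%N i; have := zd j (vdist u v); rewrite z0 zk leqnn jk leq0n (leq_trans ij jk).
move=> /(_ isT) h1 /(_ isT) h2; clear -h1 h2 ij jk; lia.
Qed.

End Realization.

(** * Exponents that work for all pairs of loxodromic elements *)

Section Uniform.
Variables (R : realType) (G : groupType) (e : R) (X : hyp_action G e).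
Variables (K L : R).

(* From this exponent on, powers of loxodromic elements have displacement at
   least [125 * (e + 1)]; its inverse bounds translation lengths from below. *)
Definition root_threshold : nat :=
  (Num.truncn (acyl_bound K (125 * (e + 1) + 24 * e))).+1.

Definition overlap_count : nat := (Num.truncn (acyl_bound K (54 * e))).+1.

(** Twenty times the left side in [projection_condition] is [80 * (Q + 1) * r + 20 * (560 * e + L +
    50)], with [Q] the overlap count and [r = S / n]. The root threshold times [r] is at least [1],
    which turns the constant into a multiple of [r]. *)
Definition exponent_bound : R :=
  root_threshold%:R + overlap_count%:R + 80 * (overlap_count%:R + 1) +
  20 * (560 * e + L + 50) * root_threshold%:R.

Hypotheses (acy : acyl X K L) (L0 : 0 <= L).

Lemma exponent_bound_ge n : exponent_bound <= n%:R ->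
  (root_threshold <= n)%N /\ (overlap_count <= n)%N.
Proof.
have e0 := e_ge0 X; have := L0 => L0'; rewrite /exponent_bound => le.
have r0 : 0 <= root_threshold%:R :> R by exact: ler0n.
have q0 : 0 <= overlap_count%:R :> R by exact: ler0n.
have : 0 <= 20 * (560 * e + L + 50) * root_threshold%:R by rewrite mulr_ge0 //; lra.
by split; rewrite -(ler_nat R); lra.
Qed.

Lemma exponent_bound_gt0 : 0 < exponent_bound.
Proof.
have e0 := e_ge0 X; have := L0 => L0'; rewrite /exponent_bound.
have r0 : 0 <= root_threshold%:R :> R by exact: ler0n.
have q0 : 0 <= overlap_count%:R :> R by exact: ler0n.
have : 0 <= 20 * (560 * e + L + 50) * root_threshold%:R by rewrite mulr_ge0 //; lra.
by lra.
Qed.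

Lemma power_displacement a n (x : pt X) : loxodromic X a -> exponent_bound <= n%:R ->
  125 * (e + 1) <= dist x (gact (a ^+ n)%g x).
Proof.
move=> la /exponent_bound_ge[rn _]; have e0 := e_ge0 X.
apply: (loxodromic_power_displacement x acy L0 _ la).
- by lra.
- by apply: lt_le_trans (truncnS_gt _) _; rewrite ler_nat.
- exact: leq_trans rn.
Qed.

Lemma projection_condition a n (x : pt X) : loxodromic X a -> exponent_bound <= n%:R ->
  isMin (a ^+ n)%g x ->
  let S := dist x (gact (a ^+ n)%g x) in
  2 * (2 * (overlap_count%:R * (S / n%:R)) + 2 * (S / n%:R + 60 * e + 10) + 100 * e) +
       L + 120 * e + 10 <= S / 20.
Proof.
move=> la nbig Mx /=; set S := dist _ _; have e0 := e_ge0 X; have := L0 => L0'.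
have [rn qn] := exponent_bound_ge nbig.
have n0 : (0 < n)%N by exact: leq_trans rn.
have nR : 0 < n%:R :> R by rewrite ltr0n.
have S125 : 125 * (e + 1) <= S by exact: power_displacement.
set r := S / n%:R; set N := root_threshold%:R : R; set Q := overlap_count%:R : R.
(* The power [N] displaces [x] by at least [125 * (e + 1)] and by at most [N * r + 24 * e]. *)
have Nr : 1 <= N * r.
  have Sbig : 100 * (e + 1) <= S by lra.
  have := root_displacement_le root_threshold n0 Mx Sbig.
  have : 125 * (e + 1) <= dist x (gact (a ^+ root_threshold)%g x).
    apply: (loxodromic_power_displacement x acy L0 _ la) => //; first by lra.
    exact: truncnS_gt.
  by rewrite -/S -/r -/N; lra.
have r0 : 0 <= r by rewrite divr_ge0 ?ler0n //; lra.
have SE : S = n%:R * r by rewrite /r mulrC divfK // lt0r_neq0.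
have : exponent_bound * r <= n%:R * r by rewrite ler_wpM2r.
rewrite -SE /exponent_bound -/N -/Q.
have C0 : 0 <= 20 * (560 * e + L + 50) by lra.
have : 20 * (560 * e + L + 50) * 1 <= 20 * (560 * e + L + 50) * (N * r).
  by rewrite ler_wpM2l.
have N0 : 0 <= N * r by lra.
have Q0 : 0 <= Q * r by rewrite mulr_ge0 ?ler0n.
by lra.
Qed.

Lemma growth_ratio (I : eqType) (f : I -> G) (ia ib : I) a b n m (xa xb : pt X) :
  (forall i, i = ia \/ i = ib) -> f ia = (a ^+ n)%g -> f ib = (b ^+ m)%g ->
  loxodromic X a -> loxodromic X b ->
  (forall i j, (0 < i)%N -> (0 < j)%N -> ~ commute (a ^+ i)%g (b ^+ j)%g) ->
  exponent_bound <= n%:R -> exponent_bound <= m%:R ->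
  isMin (X := X) (a ^+ n)%g xa -> isMin (X := X) (b ^+ m)%g xb ->
  dist xb (gact (b ^+ m)%g xb) / m%:R <= dist xa (gact (a ^+ n)%g xa) / n%:R ->
  exists x : pt X, forall w : seq (I * bool), reduced w ->
    (size w)%:R <= dist x (gact (word_eval f w) x).
Proof.
move=> Iab fa fb la lb ncomm nbig mbig Ma Mb ratio; have e0 := e_ge0 X.
have [rn qn] := exponent_bound_ge nbig; have [rm _] := exponent_bound_ge mbig.
have biga (z : pt X) : 100 * (e + 1) <= dist z (gact (a ^+ n)%g z).
  by have := power_displacement z la nbig; lra.
have bigb (z : pt X) : 100 * (e + 1) <= dist z (gact (b ^+ m)%g z).
  by have := power_displacement z lb mbig; lra.
have n0 : (0 < n)%N by exact: leq_trans rn.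
have m0 : (0 < m)%N by exact: leq_trans rm.
have [||x Mx proj] := projection_bound xa acy L0 n0 m0 qn (truncnS_gt _) biga bigb _ _ ncomm.
- move=> x y Mx My.
  by rewrite (isMin_displacement Ma Mx) (isMin_displacement Mb My).
- by move=> x Mx; apply: projection_condition.
exists x; apply: (orbit_growth (ia := ia) (ib := ib) (y := xb)); rewrite ?fa ?fb //.
Qed.

(** The generator with the larger displacement per exponent takes the role of [ia] in
    [growth_ratio]; the map [f] is the same in both cases. *)
Lemma growth a b n m (x0 : pt X) :
  loxodromic X a -> loxodromic X b ->
  (forall i j, (0 < i)%N -> (0 < j)%N -> ~ commute (a ^+ i)%g (b ^+ j)%g) ->
  exponent_bound <= n%:R -> exponent_bound <= m%:R ->
  exists (f : 'I_2 -> G) (x : pt X), range f = [set (a ^+ n)%g; (b ^+ m)%g] /\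
    forall w : seq ('I_2 * bool), reduced w ->
      (size w)%:R <= dist x (gact (word_eval f w) x).
Proof.
move=> la lb ncomm nbig mbig.
have [xa Ma] := ex_isMin (a ^+ n)%g (inhabits x0).
have [xb Mb] := ex_isMin (b ^+ m)%g (inhabits x0).
pose i1 : 'I_2 := lift ord0 ord0.
have I2 (i : 'I_2) : i = ord0 \/ i = i1.
  by have [j ->|->] := unliftP ord0 i; [right; rewrite ord1|left].
pose f (i : 'I_2) := if i == ord0 then (a ^+ n)%g else (b ^+ m)%g.
exists f.
have rf : range f = [set (a ^+ n)%g; (b ^+ m)%g].
  apply/seteqP; split=> [_ [i _ <-]|_ [|] ->].
  - by rewrite /f; case: ifP; [left|right].
  - by exists ord0.
  - by exists i1.
have [le|le] := leP (dist xb (gact (b ^+ m)%g xb) / m%:R) (dist xa (gact (a ^+ n)%g xa) / n%:R).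
  by have [x grow] := growth_ratio (f := f) I2 erefl erefl la lb ncomm nbig mbig Ma Mb le; exists x.
have I2' (i : 'I_2) : i = i1 \/ i = ord0 by case: (I2 i); [right|left].
have ncomm' i j : (0 < i)%N -> (0 < j)%N -> ~ commute (b ^+ i)%g (a ^+ j)%g.
  by move=> i0 j0 /commute_sym; apply: ncomm.
have [x grow] := growth_ratio (f := f) I2' erefl erefl lb la ncomm' mbig nbig Mb Ma (ltW le).
by exists x.
Qed.

End Uniform.

(** * Free groups and quasi-isometric orbits *)

Section GeneratedWords.
Variables (G : groupType) (S : set G).
Implicit Types (g h : G).

Definition spells (s : seq G) g : Prop :=
  (forall h, h \in s -> S h \/ S h^-1%g) /\ (\prod_(h <- s) h)%g = g.

Lemma spells_cat s t g h : spells s g -> spells t h -> spells (s ++ t) (g * h)%g.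
Proof.
move=> [Ss <-] [St <-]; split; last by rewrite big_cat.
by move=> x; rewrite mem_cat => /orP[/Ss|/St].
Qed.

Lemma spellsV s g : spells s g -> exists t, spells t g^-1%g.
Proof.
elim: s g => [|h s IH] g [Sh <-].
  by exists [::]; split=> //; rewrite big_nil invg1.
have [|t st] := IH (\prod_(k <- s) k)%g.
  by split=> // k ks; apply: Sh; rewrite inE ks orbT.
exists (t ++ [:: h^-1%g]); rewrite big_cons invgM; apply: spells_cat st _.
split; last by rewrite big_seq1.
move=> k; rewrite inE => /eqP ->; rewrite invgK.
by have [hS|hS] := Sh h (mem_head _ _); [right|left].
Qed.

Lemma generated_spells g : generated S g -> exists s, spells s g.
Proof.
apply: (smallest_sub (X := [set g | exists s, spells s g])).
  split=> [|x y [s ss] [t st]|x [s ss]] /=.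
  - by exists [::]; split=> //; rewrite big_nil.
  - by exists (s ++ t); apply: spells_cat.
  - exact: spellsV ss.
move=> h Sh /=; exists [:: h]; split; last by rewrite big_seq1.
by move=> k; rewrite inE => /eqP ->; left.
Qed.

Lemma generated_subgroup : is_subgroup (generated S).
Proof.
split=> [|x y Sx Sy|x Sx] T TS; have [[T1 TM TV] _] := TS; first by [].
  exact: TM (Sx _ TS) (Sy _ TS).
exact: TV (Sx _ TS).
Qed.

Lemma sub_generated g : S g -> generated S g.
Proof. exact: sub_gen_smallest. Qed.

Variable R : realType.

Lemma word_length_le s g : spells s g -> word_length R S g <= (size s)%:R.
Proof.
move=> sg; apply: ge_inf; last by exists s.
by exists 0 => _ [t _ <-]; exact: ler0n.
Qed.

Lemma word_length_ge g (c : R) : generated S g ->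
  (forall s, spells s g -> c <= (size s)%:R) -> c <= word_length R S g.
Proof.
move=> Sg le; have [s ss] := generated_spells Sg.
by apply: lb_le_inf; [exists (size s)%:R, s|move=> _ [t st <-]; exact: le].
Qed.

End GeneratedWords.

Section FreeWords.
Variables (G : groupType) (I : eqType) (f : I -> G).
Implicit Types (u v : I * bool) (w : seq (I * bool)).

Let adj u v := v != (u.1, ~~ u.2).

Lemma word_evalV w : exists w', word_eval f w' = (word_eval f w)^-1%g.
Proof.
elim: w => [|u w [w' IH]]; first by exists [::]; rewrite word_eval_nil invg1.
exists (w' ++ [:: (u.1, ~~ u.2)]).
rewrite word_eval_cat !word_eval_cons word_eval_nil mulg1 IH invgM.
by case: (u.2); rewrite /= ?invgK.
Qed.

Lemma exists_reduced w : exists2 w', reduced w' & word_eval f w' = word_eval f w.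
Proof.
elim: w => [|u w [w' red' E]]; first by exists [::].
have -> : word_eval f (u :: w) = word_eval f (u :: w') by rewrite !word_eval_cons E.
case: w' => [|v w'] in red' {E} *; first by exists [:: u].
have [vu|vu] := eqVneq v (u.1, ~~ u.2); last by exists [:: u, v & w']; rewrite // /reduced /= vu.
exists w'; first by move: red'; rewrite /reduced /=; case: (w') => //= a s /andP[].
by rewrite vu !word_eval_cons /=; case: (u.2); rewrite /= ?mulKg ?mulVKg.
Qed.

Lemma generated_word g : generated (range f) g -> exists2 w, reduced w & word_eval f w = g.
Proof.
move=> gg; suff [w <-] : exists w, word_eval f w = g by exact: exists_reduced.
move: gg; apply: (smallest_sub (X := [set g | exists w, word_eval f w = g])).
  split=> [|x y [s <-] [t <-]|x [s <-]] /=.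
  - by exists [::]; rewrite word_eval_nil.
  - by exists (s ++ t); rewrite word_eval_cat.
  - exact: word_evalV.
by move=> _ [i _ <-] /=; exists [:: (i, true)]; rewrite word_eval_cons word_eval_nil mulg1.
Qed.

Lemma reduced_powers u w k : path adj u w -> adj (last u w) u ->
  reduced (flatten (nseq k (u :: w))).
Proof.
move=> uw wu; have main : forall k v, adj v u -> path adj v (flatten (nseq k (u :: w))).
  by elim=> //= n IH v vu; rewrite vu cat_path uw IH.
by case: k => // k; rewrite /reduced /= cat_path uw; apply: main.
Qed.

Lemma word_eval_powers w k : word_eval f (flatten (nseq k w)) = (word_eval f w ^+ k)%g.
Proof.
elim: k => [|k IH]; first by rewrite word_eval_nil.
by rewrite /= word_eval_cat IH expgS.
Qed.

(** Stripping a cancelling pair of first and last letters conjugates the element. Once none is left,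
    all powers of the word are reduced, so that growth applies to each of them. *)
Lemma cyclic_reduction w : reduced w -> word_eval f w <> 1%g ->
  exists g w', [/\ word_eval f w = (g * word_eval f w' * g^-1)%g, (0 < size w')%N &
    forall k, reduced (flatten (nseq k w'))].
Proof.
have [n] := ubnP (size w); elim: n w => // n IH [|u w]; first by rewrite word_eval_nil.
move=> szw red n1.
have [cyc|ncyc] := boolP (adj (last u w) u).
  exists 1%g, (u :: w); split=> // [|k]; first by rewrite mul1g invg1 mulg1.
  exact: reduced_powers.
(* A one-letter word cannot occur here, a letter never being its own formal inverse. *)
case: (lastP w) => [|w' v] in szw red n1 ncyc *.
  move: ncyc; rewrite /adj /= negbK => /eqP E.
  by have := congr1 snd E; rewrite /=; case: (u.2).
rewrite last_rcons /adj negbK in ncyc.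
have E : word_eval f (u :: rcons w' v) =
    (signed (f u.1) u.2 * word_eval f w' * (signed (f u.1) u.2)^-1)%g.
  rewrite word_eval_cons -cats1 word_eval_cat word_eval_cons word_eval_nil mulg1 mulgA.
  by rewrite (eqP ncyc) /=; case: (v.2); rewrite /= ?invgK.
have red' : reduced w'.
  move: red; rewrite /reduced /= rcons_path => /andP[+ _].
  by case: (w') => //= a s /andP[].
have [||g [x [eqx x0 redx]]] := IH w' _ red'.
- by move: szw; rewrite /= size_rcons => /ltnW.
- by move=> w1; apply: n1; rewrite E w1 mulg1 mulgV.
exists (signed (f u.1) u.2 * g)%g, x; split=> //.
by rewrite E eqx invgM !mulgA.
Qed.

End FreeWords.

Section QuasiIsometry.
Variables (R : realType) (G : groupType) (Y : Type) (d : Y -> Y -> R) (act : G -> Y -> Y).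
Variables (I : finType) (f : I -> G) (p0 : Y).
Hypotheses (dxx : forall x, d x x = 0) (dC : forall x y, d x y = d y x)
  (d_tri : forall y x z, d x z <= d x y + d y z) (actP : isometric_action d act).
Hypothesis grow : forall w : seq (I * bool), reduced w ->
  (size w)%:R <= d p0 (act (word_eval f w) p0).

Lemma growth_free w : reduced w -> w != [::] -> word_eval f w <> 1%g.
Proof.
move=> red w0 w1; have [a1 _ _] := actP.
by have := grow red; rewrite w1 a1 dxx lern0; case: w w0 {red w1}.
Qed.

Lemma iter_act g k p : iter k (act g) p = act (g ^+ k)%g p.
Proof.
have [a1 aM _] := actP; elim: k => [|k IH]; first by rewrite a1.
by rewrite iterS IH expgS aM.
Qed.

Lemma growth_hyperbolic h : generated (range f) h -> h <> 1%g ->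
  hyperbolic_isometry d (act h).
Proof.
move=> /generated_word[w red <-] w1; have [a1 aM iso] := actP.
have [g [v [-> v0 redv]]] := cyclic_reduction red w1.
exists (act g p0), 1; split=> // n n0.
rewrite iter_act conj_expg !aM.
rewrite -(aM g^-1%g) mulVg a1 iso -word_eval_powers mul1r.
apply: le_trans (grow (redv n)); rewrite ler_nat size_flatten /shape map_nseq sumn_nseq.
by rewrite leq_pmull.
Qed.

Lemma finite_displacement (S : set G) p : finite_set S ->
  exists2 A : R, 0 < A & forall g, S g -> d p (act g p) <= A.
Proof.
move=> /finite_seqP[s ->].
elim: s => [|g s [A A0 IH]]; first by exists 1.
exists (Num.max A (d p (act g p))) => [|h /=]; first by rewrite lt_max A0.
rewrite in_cons => /orP[/eqP ->|hs]; rewrite le_max ?lexx ?orbT //.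
by rewrite IH.
Qed.

Lemma displacement_spells (S : set G) A p s g : 0 <= A ->
  (forall h, S h -> d p (act h p) <= A) -> spells S s g ->
  d p (act g p) <= A * (size s)%:R.
Proof.
move=> A0 SA [Ss <-]; have [a1 aM iso] := actP.
elim: s Ss => [|h s IH] Ss; first by rewrite big_nil a1 dxx mulr0.
have hA : d p (act h p) <= A.
  have [|/SA|/SA] // := Ss h; first by rewrite inE eqxx.
  by rewrite -(iso h) -aM mulgV a1 dC.
have IH' := IH (fun k ks => Ss k (mem_behead (s := h :: s) ks)).
have := d_tri (act h p) p (act (\prod_(k <- h :: s) k)%g p).
by rewrite big_cons aM iso /= -natr1; lra.
Qed.

(** Spelling each basis letter in [S] costs at most a factor [B], so [grow] bounds the [S]-length by
    the displacement; changing the base point costs [2 * d p p0]. Conversely each letter of [S]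
    moves [p] by at most [A]. *)
Lemma growth_quasi_isometric (S : set G) p : finite_set S ->
  generated S = generated (range f) -> qi_orbit_embedding d act S p.
Proof.
move=> finS genS; have [a1 aM iso] := actP.
have [A A0 SA] := finite_displacement p finS.
have letter (u : I * bool) : exists s, spells S s (signed (f u.1) u.2).
  apply: generated_spells; rewrite genS.
  have fu : generated (range f) (f u.1) by apply: sub_generated; exists u.1.
  by case: (u.2) => //=; have [_ _] := generated_subgroup (range f); apply.
have [sp spP] := choice letter.
pose B := (\max_u size (sp u))%N.
have spell_word w : exists2 s, spells S s (word_eval f w) & (size s <= B * size w)%N.
  elim: w => [|u w [s ss les]].
    by exists [::] => //; split=> //; rewrite big_nil word_eval_nil.
  exists (sp u ++ s); first by rewrite word_eval_cons; apply: spells_cat.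
  by rewrite size_cat /= mulnS leq_add // leq_bigmax.
have d0 x y : 0 <= d x y.
  by have := d_tri y x x; rewrite dxx (dC y x); lra.
exists (A + B%:R + 1), (2 * d p p0 + 1).
have B0 : 0 <= B%:R :> R by exact: ler0n.
have dpp := d0 p p0.
split; [lra|lra|move=> h Sh; apply/andP; split].
  have [w red hw] : exists2 w, reduced w & word_eval f w = h.
    by apply: generated_word; rewrite -genS.
  have [s ss les] := spell_word w; rewrite hw in ss.
  have lw := grow red; rewrite hw in lw.
  have := d_tri p p0 (act h p0); have := d_tri (act h p) p (act h p0).
  rewrite iso (dC p0 p) => t1 t2.
  rewrite lerBlDr ler_pdivrMr; last by lra.
  apply: le_trans (word_length_le R ss) _.
  have : (size s)%:R <= B%:R * (size w)%:R :> R by rewrite -natrM ler_nat.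
  have : B%:R * (size w)%:R <= B%:R * (d p (act h p) + 2 * d p p0).
    by rewrite ler_wpM2l //; lra.
  have D0 := d0 p (act h p).
  have : 0 <= A * (d p (act h p) + (2 * d p p0 + 1)) by rewrite mulr_ge0 ?ltW //; lra.
  by lra.
have : d p (act h p) / A <= word_length R S h.
  apply: word_length_ge => // s ss; rewrite ler_pdivrMr // mulrC.
  exact: displacement_spells (ltW A0) SA ss.
rewrite ler_pdivrMr // => le.
have W0 : 0 <= word_length R S h by apply: word_length_ge => // s _; exact: ler0n.
have : 0 <= B%:R * word_length R S h by rewrite mulr_ge0.
by lra.
Qed.

End QuasiIsometry.

(** * The induced action on the vertices of the graph *)

Section VertexAction.
Variables (R : realType) (Gam : graph) (delta : R).
Variables (G : groupType) (act : G -> gpoint R Gam -> gpoint R Gam).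
Hypotheses (delta0 : 0 <= delta) (hyp : hyperbolic_space (@gdist R Gam) delta).
Hypothesis actP : graph_action act.

Let geo : geodesic_space (@gdist R Gam). Proof. by case: hyp. Qed.

Definition vact (g : G) (v : vertex Gam) : vertex Gam :=
  if act g (Vtx R v) is Vtx w then w else v.

Lemma vactE g v : act g (Vtx R v) = Vtx R (vact g v).
Proof. by rewrite /vact; have [_ /(_ g)[/(_ v)[w ->]]] := actP. Qed.

Lemma three_delta_ge0 : 0 <= 3 * delta.
Proof. by rewrite mulr_ge0. Qed.

Lemma vdistxx (u : vertex Gam) : vdist R u u = 0%N.
Proof. by apply/eqP; rewrite -(eqr_nat R) -vdistE // gdistxx. Qed.

Lemma vdistC (u v : vertex Gam) : vdist R u v = vdist R v u.
Proof. by apply/eqP; rewrite -(eqr_nat R) -!vdistE // gdistC. Qed.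

Lemma vdist_four_point (x y u v : vertex Gam) :
  (vdist R x y + vdist R u v)%:R <= (vdist R x u + vdist R y v)%:R + 2 * (3 * delta) \/
  (vdist R x y + vdist R u v)%:R <= (vdist R x v + vdist R y u)%:R + 2 * (3 * delta).
Proof.
rewrite !natrD -!vdistE //; apply: slim_four_point => //.
- exact: gdistC.
- exact: gdist_triangle.
- exact: gdistxx.
Qed.

Lemma vact1 v : vact 1%g v = v.
Proof. by have [[a1 _ _] _] := actP; rewrite /vact a1. Qed.

Lemma vactM g h v : vact (g * h)%g v = vact g (vact h v).
Proof.
have [[_ aM _] _] := actP.
by have := aM g h (Vtx R v); rewrite !vactE => -[].
Qed.

Lemma vdist_vact g u v : vdist R (vact g u) (vact g v) = vdist R u v.
Proof.
have [[_ _ iso] _] := actP.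
by apply/eqP; rewrite -(eqr_nat R) -!vdistE // -!vactE iso.
Qed.

Definition vertex_action : hyp_action G (3 * delta) :=
  HypAction three_delta_ge0 vdistxx vdistC (vdist_triangle geo) vdist_four_point
    (vdist_geodesic geo) vact1 vactM vdist_vact.

Lemma vertex_dist (u v : pt vertex_action) : dist u v = gdist (Vtx R u) (Vtx R v).
Proof. by rewrite vdistE. Qed.

Lemma vertex_gact g (v : pt vertex_action) : Vtx R (gact g v) = act g (Vtx R v).
Proof. by rewrite vactE. Qed.

Lemma card_le_uniq (T : eqType) (A : set T) (s : seq T) k :
  uniq s -> (forall x, x \in s -> A x) -> (A #<= `I_k)%card -> (size s <= k)%N.
Proof.
move=> us sA Ak; rewrite -card_le_II; apply: card_le_trans Ak.
case: s => [|x0 s] in us sA *; first by rewrite II0 card_ge0.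
have nth_inj : {in `I_(size (x0 :: s)) &, injective (nth x0 (x0 :: s))}.
  move=> i j; rewrite !inE => ilt jlt /eqP.
  by rewrite nth_uniq // => /eqP.
rewrite -(card_le_eql (inj_card_eq nth_inj)); apply: subset_card_le.
by move=> _ [i ilt <-]; apply/sA/mem_nth.
Qed.

Lemma vertex_acyl (K L : R -> R) : acylindrical act K L ->
  acyl vertex_action (K (20 * delta)) (L (20 * delta)).
Proof.
move=> acy x y far s us small; have d0 := delta0.
have [|_ _ /(_ x y)] := acy (20 * delta); first by rewrite mulr_ge0.
rewrite -vertex_dist => /(_ far)[k kK Ak]; apply: le_trans kK.
rewrite ler_nat; apply: card_le_uniq us _ Ak => g /small[gx gy] /=.
by rewrite -!vertex_gact -!vertex_dist; split; lra.
Qed.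

Lemma ex_near_vertex (p : gpoint R Gam) : exists v : vertex Gam, True.
Proof. by case: p => [v|ed _]; [exists v|exists (end0 ed)]. Qed.

Lemma vertex_loxodromic g : hyperbolic_isometry (@gdist R Gam) (act g) ->
  loxodromic vertex_action g.
Proof.
move=> [p [c [c0 pc]]]; have [v _] := ex_near_vertex p.
have [actI _] := actP; have [_ _ iso] := actI.
exists v, c, (2 * gdist (Vtx R v) p); split=> // k.
rewrite vertex_dist vertex_gact.
have : k%:R * c <= gdist p (act (g ^+ k)%g p).
  case: k => [|k]; first by rewrite mul0r; apply: gdist_ge0.
  by rewrite mulrC -(iter_act actI) pc.
have := gdist_triangle geo (Vtx R v) p (act (g ^+ k)%g p).
have := gdist_triangle geo (act (g ^+ k)%g (Vtx R v)) (Vtx R v) (act (g ^+ k)%g p).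
rewrite iso (gdistC p (Vtx R v)).
by lra.
Qed.

End VertexAction.

Theorem theorem14 (R : realType) :
  exists M : R -> R -> R -> R -> R,
  forall (G : groupType) (Gam : graph) (act : G -> gpoint R Gam -> gpoint R Gam)
         (delta : R) (K L : R -> R),
    0 <= delta ->
    hyperbolic_space (@gdist R Gam) delta ->
    graph_action act ->
    acylindrical act K L ->
  forall a b : G,
    hyperbolic_isometry (@gdist R Gam) (act a) ->
    hyperbolic_isometry (@gdist R Gam) (act b) ->
    (forall p q : int, p != 0 -> q != 0 ->
       ([~ zpow a p, zpow b q] <> 1)%g) ->
  forall n m : int,
    M delta (K (20 * delta)) (L (20 * delta)) (K (200 * delta)) <= n%:~R ->
    M delta (K (20 * delta)) (L (20 * delta)) (K (200 * delta)) <= m%:~R ->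
  let H := generated [set zpow a n; zpow b m] in
  [/\ free_of_rank 2 H,
      forall (S : set G) (x : gpoint R Gam),
        finite_set S -> generated S = H ->
        qi_orbit_embedding (@gdist R Gam) act S x
    & forall h, H h -> h <> 1%g -> hyperbolic_isometry (@gdist R Gam) (act h)].
Proof.
exists (fun delta k l _ => exponent_bound (3 * delta) k l).
move=> G Gam act delta K L delta0 hyp actP acy a b ha hb ncomm n m nbig mbig H.
have geo : geodesic_space (@gdist R Gam) by case: hyp.
have [actI _] := actP.
set X := vertex_action delta0 hyp actP.
have acyX : acyl X (K (20 * delta)) (L (20 * delta)) by apply: vertex_acyl.
have d20 : 0 <= 20 * delta by rewrite mulr_ge0.
have [_ L1 _] := acy _ d20.
have L0 : 0 <= L (20 * delta) by lra.
(* Positivity of the bound forces the integers [n] and [m] to be natural numbers. *)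
have M0 := exponent_bound_gt0 X (K (20 * delta)) L0.
have nat_exp (k : int) : exponent_bound (3 * delta) (K (20 * delta)) (L (20 * delta)) <= k%:~R ->
    exists k', k = Posz k'.
  case: k => [k|k] le; first by exists k.
  by have := lt_le_trans M0 le; rewrite ltr0z.
have [n' En] := nat_exp n nbig; have [m' Em] := nat_exp m mbig.
rewrite En Em in nbig mbig H *.
have ncomm' i j : (0 < i)%N -> (0 < j)%N -> ~ commute (a ^+ i)%g (b ^+ j)%g.
  move=> i0 j0 /commgP/eqP; apply: (ncomm (Posz i) (Posz j)).
    by rewrite eqz_nat -lt0n.
  by rewrite eqz_nat -lt0n.
have [x0 _] : exists x0 : vertex Gam, True by have [p _] := ha; apply: ex_near_vertex p.
have [f [x [rf grow]]] := growth acyX L0 (x0 : pt X) (vertex_loxodromic delta0 hyp actP ha)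
  (vertex_loxodromic delta0 hyp actP hb) ncomm' nbig mbig.
have grow' (w : seq ('I_2 * bool)) : reduced w ->
    (size w)%:R <= gdist (Vtx R x) (act (word_eval f w) (Vtx R x)).
  by move=> /grow; rewrite vertex_dist vertex_gact.
have HE : H = generated (range f) by rewrite rf.
have gxx := gdistxx geo; have gtri := gdist_triangle geo.
have gC := @gdistC R Gam.
split.
- exists f; split; first by rewrite HE.
  by move=> w red w0; apply: (growth_free gxx actI grow').
- move=> S p finS genS; apply: (growth_quasi_isometric gxx gC gtri actI grow') => //.
  by rewrite genS.
- by move=> h; rewrite HE; apply: (growth_hyperbolic actI grow').
Qed.
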